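(* Let $p$ be a prime and $\alpha,\beta$ integers different from $1$, and assume that either $p>3$, or $p=3$ and neither $\alpha$ nor $\beta$ is congruent to $7$ modulo $9$. Suppose $v_p(\alpha-1)=v_p(\beta-1)=m>0$ and that $\ell=v_p(\alpha-\beta)$ satisfies $m<\ell<2m$ and $2\ell<3m$. Then $|G_p|=p^{2m+3\ell}$, the nilpotency class of $G_p$ is $5$, $o(a)=o(b)=p^{m+\ell}$ and $o(c)=p^{2\ell-m}$.
   Context: $G(\alpha,\beta)=\langle A,B\mid A^{[A,B]}=A^{\alpha},\ B^{[B,A]}=B^{\beta}\rangle$ with $[x,y]=x^{-1}y^{-1}xy$, $y^x=x^{-1}yx$, and $C=[A,B]$. The group $G(\alpha,\beta)$ is finite and nilpotent, hence the direct product of its Sylow subgroups; $G_p$ denotes its Sylow $p$-subgroup and $a,b,c$ denote the images of $A,B,C$ under the canonical projection $G(\alpha,\beta)\to G_p$. $v_p$ is the $p$-adic valuation and $o(x)$ the order of $x$. *)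

(* Defs.v *)
From mathcomp Require Import all_boot all_order all_algebra all_fingroup all_solvable.
Set Implicit Arguments. Unset Strict Implicit. Unset Printing Implicit Defensive.
Local Open Scope group_scope.

Definition zexpg (gT : finGroupType) (x : gT) (z : int) : gT :=
  match z with
  | Posz n => x ^+ n
  | Negz n => x ^- n.+1
  end.

(* The defining relations of G(alpha,beta):
   A^[A,B] = A^alpha,  B^[B,A] = B^beta,
   with [x,y] = x^-1 y^-1 x y  (= mathcomp's [~ x, y])
   and y^x = x^-1 y x          (= mathcomp's y ^ x). *)
Definition Grels (gT : finGroupType) (alpha beta : int) (x y : gT) : Prop :=
  x ^ [~ x, y] = zexpg x alpha /\ y ^ [~ y, x] = zexpg y beta.

(* G (a subgroup of gT) together with elements A, B is (a copy of) the group
   G(alpha,beta) = < A, B | A^[A,B] = A^alpha, B^[B,A] = B^beta >,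
   where the group is known to be finite: G is generated by A and B, the
   relations hold, and G is universal among finite groups: any pair of
   elements of a finite group satisfying the relations is the image of
   (A, B) under a group morphism defined on G. *)
Definition is_Galphabeta (gT : finGroupType) (G : {group gT}) (A B : gT)
    (alpha beta : int) : Prop :=
  [/\ G :=: <<[set A; B]>>,
      Grels alpha beta A B &
      forall (hT : finGroupType) (x y : hT), Grels alpha beta x y ->
        exists f : {morphism G >-> hT}, f A = x /\ f B = y].

(* Main.v *)
(* The relation A^C = A^alpha, C = [A, B], gives (A^n)^B = (A C)^n = C^n A^(alpha (1 + ... +
   alpha^(n-1))), so that G = <B><C><A> as a set.

   Nilpotency: if the s-part c of C centralises the s'-parts of A and B, then <b><c><a> is a
   normal s-subgroup; applied to primes s in decreasing order, a Frattini argument shows that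
   alpha = 1 modulo every prime dividing the order of A (and likewise for B), and then the
   p-part and the p'-part of G split off as direct factors.

   Upper bound: expanding A^(C B C^-1) = A^(B^beta) in two ways gives b^Z a^Y = c^(alpha -
   beta) with v_p(Z) = v_p(Y) = 2m; conjugating it by b gives b^(beta^(alpha-beta) - 1) = c^Y
   a^j with p^(3m) | j. Eliminating b, and exchanging the roles of a and b, shows that
   c^(p^(2l-m)), a^(p^(m+l)) and b^(p^(m+l)) generate the same subgroup, which the second
   relation forces to be trivial. Since c^(p^l) lies in <b^(p^2m)><a^(p^2m)>, only p^l powers of
   c are needed in P = <b><c><a>.

   Lower bound: on the cosets <B> C^x A^y the generators act by A : (x, y) -> (x, y + 1) and
   B : (x, y) -> (x + y, alpha (1 + ... + alpha^(y-1))). Over R = Z/p^(m+l), with u = alpha - 1,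
   the last map becomes y |-> y + u y (y + 1) / 2 + u^2 (y^3 - y) / 6, and the relations hold on
   the quotient of R x R by the multiples of (alpha - beta, - u^2 / 2). This transitive action
   has degree p^(m+2l) and B fixes a point; in the action obtained by exchanging A and B, B has
   order p^(m+l). Hence p^(2m+3l) divides the order of G. *)
Require Import Defs.
From mathcomp Require Import all_boot all_order all_algebra all_fingroup all_solvable.
From mathcomp Require Import zify ring.
Set Implicit Arguments. Unset Strict Implicit. Unset Printing Implicit Defensive.

(** * Geometric sums and the basic relator *)

Section BasicRelator.
Definition geom (x n : nat) := \sum_(k < n) x ^ k.

Lemma geom0 x : geom x 0 = 0.
Proof. exact: big_ord0. Qed.

Lemma geomS x n : geom x n.+1 = 1 + x * geom x n.
Proof.
rewrite /geom big_ord_recl expn0 big_distrr /=; congr (_ + _).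
by apply: eq_bigr => i _; rewrite -expnS.
Qed.

Lemma geomSr x n : geom x n.+1 = geom x n + x ^ n.
Proof. exact: big_ord_recr. Qed.

Lemma geom_mul u n : u * geom u.+1 n + 1 = u.+1 ^ n.
Proof.
elim: n => [|n IHn]; first by rewrite geom0 muln0.
by rewrite geomSr expnS -IHn; nia.
Qed.

(** This is ((1 + u)^n - 1) / u expanded by the binomial theorem; all terms after the third carry
    [u ^ 3]. *)
Lemma geom_expansion u n : exists e,
  geom u.+1 n = n + u * 'C(n, 2) + u ^ 2 * 'C(n, 3) + u ^ 3 * e.
Proof.
elim: n => [|n [e IHn]]; first by exists 0; rewrite geom0 !bin0n !muln0.
exists (e + 'C(n, 3) + u * e); rewrite geomS IHn !binS bin1.
ring.
Qed.

Lemma geom_modn x n d : x = 1 %[mod d] -> geom x n = n %[mod d].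
Proof.
move=> x1; elim: n => [|n IHn]; first by rewrite geom0.
by rewrite geomSr -modnDm IHn -modnXm x1 modnXm exp1n modnDm addn1.
Qed.

Lemma modn1_exp x d n : x = 1 %[mod d] -> x ^ n = 1 %[mod d].
Proof. by move=> x1; rewrite -modnXm x1 modnXm exp1n. Qed.

(** Since y^q - 1 = (y - 1) [geom y q], and [geom y q] is congruent to [q] modulo [q] once y = 1
    there, each q-th power gains a factor [q]. *)
Lemma modn1_exp_prime q x k :
  0 < x -> x = 1 %[mod q] -> x ^ (q ^ k) = 1 %[mod q ^ k.+1].
Proof.
move=> x_gt0 x1; elim: k => [|k IHk]; first by rewrite expn0 !expn1.
set y := x ^ (q ^ k) in IHk; have y_gt0: 0 < y by rewrite expn_gt0 x_gt0.
have yE : y.-1.+1 = y by rewrite prednK.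
have /dvdnP[b bE] : q ^ k.+1 %| y.-1.
  by rewrite -subn1 -(eqn_mod_dvd _ y_gt0); apply/eqP.
have /dvdnP[a aE] : q %| geom y q.
  by rewrite /dvdn geom_modn ?modnn // modn1_exp.
rewrite expnSr expnM -/y -yE -geom_mul yE aE bE (expnSr q k.+1).
by rewrite -mulnA (mulnCA _ a) !mulnA -mulnA modnMDl.
Qed.

Local Open Scope group_scope.

Section Relations.
Variable gT : finGroupType.
Implicit Types x y z A B : gT.

Definition Mrels al be A B :=
  A ^ [~ A, B] = A ^+ al /\ B ^ [~ B, A] = B ^+ be.

Lemma Mrels_sym al be A B : Mrels al be A B -> Mrels be al B A.
Proof. by case. Qed.

Lemma conjg_expn al x z i n : x ^ z = x ^+ al ->
  (x ^+ i) ^ (z ^+ n) = x ^+ (i * al ^ n).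
Proof.
move=> xz; elim: n => [|n IHn]; first by rewrite conjg1 muln1.
by rewrite expgSr conjgM IHn conjXg xz -expgnA mulnCA expnS.
Qed.

Lemma expg_comm al x z i n : x ^ z = x ^+ al ->
  x ^+ i * z ^+ n = z ^+ n * x ^+ (i * al ^ n).
Proof. by move=> xz; rewrite -(conjg_expn i n xz) -conjgC. Qed.

(** Collecting the powers of [z] on the left conjugates the successive factors [x ^+ j] by powers of
    [z ^+ i], so their exponents form a geometric progression of ratio [al ^ i]. *)
Lemma expgM_geom al x z i j n : x ^ z = x ^+ al ->
  (z ^+ i * x ^+ j) ^+ n = z ^+ (i * n) * x ^+ (j * geom (al ^ i) n).
Proof.
move=> xz; elim: n => [|n IHn]; first by rewrite geom0 !muln0 mulg1.
rewrite expgSr IHn mulgA -(mulgA (z ^+ (i * n))) (expg_comm _ _ xz).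
rewrite mulgA -mulgA -!expgD; congr (_ ^+ _ * _ ^+ _).
  by rewrite mulnS addnC.
by rewrite geomS mulnDr muln1 mulnAC mulnA addnC; congr (_ + _); lia.
Qed.

Lemma conjgX_geom al A B n : A ^ [~ A, B] = A ^+ al ->
  (A ^+ n) ^ B = [~ A, B] ^+ n * A ^+ (al * geom al n).
Proof.
move=> hA; rewrite conjXg -[A ^ B](mulKVg A) -commgEl conjgC hA.
by have := expgM_geom 1 al n hA; rewrite expg1 mul1n expn1.
Qed.

Lemma expg_conjg al x z n : x ^ z = x ^+ al ->
  (z ^+ n) ^ x = z ^+ n * x ^- (al ^ n) * x.
Proof.
move=> xz; have := expg_comm 1 n xz; rewrite expg1 mul1n => E.
rewrite conjgE mulgA; congr (_ * x); apply: (mulgI x).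
by rewrite mulKVg mulgA E mulgK.
Qed.

(* Computing A ^ (C B C^-1) as A ^ (B^be) and as ((A^al) ^ B) ^ C^-1. *)
Lemma conjg_relator al be A B : Mrels al be A B ->
  A ^ (B ^+ be) = [~ A, B] ^+ al * A ^+ geom al al.
Proof.
case=> hA; rewrite -invg_comm => <-; move: hA.
have: A ^ B = A * [~ A, B] by rewrite commgEl mulKVg.
move: [~ A, B] => C AB hA.
rewrite (conjgE B) invgK !conjgM hA conjXg AB conjXg conjgE invgK !mulgA mulgK.
by have := expgM_geom 1 1 al hA; rewrite !mul1n !expg1 expn1.
Qed.

(** The exponent of [A] that remains when the two expansions of [A ^ (B ^+ be)] are compared. The
    truncated subtraction is exact by [geom_le_exp]. *)
Definition gap al := al ^ al - geom al al.

Lemma geom_le_exp al : geom al al <= al ^ al.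
Proof.
case: al => [|u]; first by rewrite geom0.
rewrite geomS -(geom_mul u) addnC leq_add2r geomSr -(geom_mul u).
by case: u => [|u]; rewrite ?geom0 ?muln0 //; nia.
Qed.

(** Because B^A = B C^-1, also A^(B^be) = A (C B^-1)^be B^be. Collecting [B] on the left and
    comparing with [conjg_relator] gives the relation. *)
Lemma expg_relator al be A B : Mrels al be A B ->
  B ^+ (be * gap be) * [~ A, B] ^+ be * A ^+ gap al = [~ A, B] ^+ al.
Proof.
move=> hAB; have := conjg_relator hAB; case: hAB => hA hB.
have BA : B ^ A = B * [~ A, B]^-1 by rewrite invg_comm commgEl mulKVg.
move: hB; rewrite -invg_comm; move: [~ A, B] BA hA => C BA hA hB hAB.
have hBi n : C * B^-1 ^+ n = B^-1 ^+ (be * n) * C.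
  have hB' : B^-1 ^ C^-1 = B^-1 ^+ be by rewrite conjVg hB expgVn.
  have := expg_comm n 1 hB'; rewrite !expg1 expn1 mulnC => E.
  by apply: (mulIg C^-1); rewrite mulgK -mulgA E mulKVg.
have CB n : C ^+ n * B ^+ be = B ^+ (be * be ^ n) * C ^+ n.
  have := expg_comm be n hB; rewrite expgVn => E.
  by apply: (mulIg (C ^- n)); rewrite mulgK -mulgA E mulKVg.
have E : (C * B^-1) ^+ be * B ^+ be = B ^+ (be * gap be) * C ^+ be.
  have D n : (C * B^-1) ^+ n = B ^- (be * geom be n) * C ^+ n.
    elim: n => [|n IHn]; first by rewrite geom0 muln0 invg1 mulg1.
    by rewrite expgS IHn geomS -!expgVn !mulgA -(mulgA C) -expgS hBi -mulgA -expgS.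
  rewrite D -mulgA CB mulgA -expgVn; congr (_ * _).
  have -> : (be * be ^ be = be * geom be be + be * gap be)%N.
    by rewrite -mulnDr subnKC ?geom_le_exp.
  by rewrite expgD mulgA expgVn mulVg mul1g.
have F : (C * B^-1) ^+ be * B ^+ be = A^-1 * (C ^+ al * A ^+ geom al al).
  rewrite -hAB (conjgE A) !mulgA; congr (_ * _).
  by rewrite -[C in LHS]invgK -invMg -BA -conjVg -conjXg conjgE mulgA expgVn.
have hA' : A^-1 ^ C = A^-1 ^+ al by rewrite conjVg hA expgVn.
rewrite -E F mulgA -{1}[A^-1]expg1 (expg_comm 1 _ hA') mul1n -!mulgA -expgD.
by rewrite addnC subnK ?geom_le_exp // expgVn mulVg mulg1.
Qed.

End Relations.
End BasicRelator.

(** * Splitting off the pi-parts *)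

Section PiCores.
Local Open Scope group_scope.

(** One exponent that extracts the pi-part of every element of a group of order [n], so that the
    formula for (A^n)^B can be read as a formula between pi-parts. *)
Definition pi_exponent (pi : nat_pred) n := chinese n`_pi n`_pi^' 1 0.

Lemma pi_exponent_modl pi n : pi_exponent pi n = 1 %[mod n`_pi].
Proof. exact/chinese_modl/coprime_partC. Qed.

Lemma pi_exponent_modr pi n : n`_pi^' %| pi_exponent pi n.
Proof. by apply/eqP; rewrite chinese_modr ?mod0n ?coprime_partC. Qed.

Section PiParts.
Variable gT : finGroupType.
Implicit Types (x y A B : gT) (G : {group gT}) (pi : nat_pred).

Lemma constt_exponent G pi x : x \in G -> x.`_pi = x ^+ pi_exponent pi #|G|.
Proof.
move=> Gx; rewrite -{2}(consttC pi x) expgMn; last first.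
  by apply: (centsP (cycle_abelian x)); rewrite cycle_constt.
have oG := order_dvdG Gx.
have -> : x.`_pi^' ^+ pi_exponent pi #|G| = 1.
  apply/eqP; rewrite -order_dvdn order_constt.
  by apply: dvdn_trans (pi_exponent_modr _ _); rewrite partn_dvd.
rewrite mulg1 -{1}[x.`_pi]expg1; apply/eqP; rewrite eq_expg_mod_order.
rewrite order_constt -(modn_dvdm (pi_exponent _ _) (partn_dvd pi _ oG)) //.
by rewrite pi_exponent_modl modn_dvdm ?partn_dvd.
Qed.

Lemma conjg_constt al pi x z : x ^ z = x ^+ al -> x.`_pi ^ z = x.`_pi ^+ al.
Proof. by move=> xz; rewrite -consttJ xz consttX. Qed.

Lemma mem_norm_cycle al x z : x ^ z = x ^+ al -> z \in 'N(<[x]>).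
Proof. by move=> xz; rewrite inE -cycleJ cycle_subG xz mem_cycle. Qed.

Lemma commute_conjg x y : commute x y -> x ^ y = x.
Proof. by move=> cxy; rewrite conjgE cxy mulKg. Qed.

Lemma commute_constt pi1 pi2 x : commute x.`_pi1 x.`_pi2.
Proof. by apply: (centsP (cycle_abelian x)); rewrite cycle_constt. Qed.

Lemma constt_conj pi x : x.`_pi ^ x = x.`_pi.
Proof.
apply: commute_conjg; apply: (centsP (cycle_abelian x)); rewrite ?cycle_id //.
exact: cycle_constt.
Qed.

Section OneSide.
Variables (pi : nat_pred) (al : nat) (A B : gT) (G : {group gT}).
Hypotheses (GA : A \in G) (GB : B \in G).
Hypothesis hA : A ^ [~ A, B] = A ^+ al.
Let C := [~ A, B].
Let a := A.`_pi.
Let c := C.`_pi.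
Hypothesis cA' : commute c (A.`_pi^').
Let r := pi_exponent pi #|G|.

Lemma cycle_constt_norm : <[c]> \subset 'N(<[a]>).
Proof.
apply: subset_trans (_ : <[C]> \subset _).
  by rewrite cycle_subG cycle_constt.
by rewrite cycle_subG (mem_norm_cycle (conjg_constt pi hA)).
Qed.

Lemma cycle_constt_joing : <[c]> <*> <[a]> = <[c]> * <[a]>.
Proof. exact: norm_joinEl cycle_constt_norm. Qed.

Lemma cycle_constt_joing_pgroup : pi.-group (<[c]> <*> <[a]>).
Proof. by rewrite cycle_constt_joing pgroupM; apply/andP; split; apply: p_elt_constt. Qed.

Lemma comm_constt_conjl : c ^ A = c ^ a.
Proof.
by rewrite -{1}(consttC pi A) commute_constt conjgM (commute_conjg cA').
Qed.

(** Put [r] for the exponent in [conjgX_geom]. The pi'-part of [A] contributes a factor that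
    commutes with the rest, and it disappears on taking pi-parts. *)
Lemma constt_conjr : a ^ B = c * a ^+ (al * geom al r).
Proof.
have GC : C \in G by rewrite groupR.
set w := (al * _)%N.
have E : a ^ B = c * a ^+ w * A.`_pi^' ^+ w.
  rewrite {1}/a (constt_exponent pi GA) (conjgX_geom _ hA) -(constt_exponent pi GC).
  rewrite -/w -mulgA -expgMn ?consttC //; exact: commute_constt.
have com : commute (c * a ^+ w) (A.`_pi^' ^+ w).
  apply/commute_sym/commuteM; first exact/commute_sym/commuteX.
  by apply/commute_sym/commuteX2/commute_constt.
have M_ca : c * a ^+ w \in <[c]> <*> <[a]>.
  by rewrite groupM ?mem_gen ?inE ?cycle_id ?mem_cycle ?orbT.
rewrite -[LHS](constt_p_elt (pi := pi)) ?p_eltJ ?p_elt_constt // E consttM //.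
rewrite (constt_p_elt (mem_p_elt cycle_constt_joing_pgroup M_ca)).
rewrite (constt1P _) ?mulg1 //; apply/p_eltX/p_elt_constt.
Qed.

End OneSide.

Section TwoSides.
Variables (pi : nat_pred) (al be : nat) (A B : gT).
Hypothesis hAB : Mrels al be A B.
Let G := <<[set A; B]>>%G.
Let C := [~ A, B].
Let a := A.`_pi.
Let b := B.`_pi.
Let c := C.`_pi.
Hypothesis cA' : commute c (A.`_pi^').
Hypothesis cB' : commute c (B.`_pi^').

Lemma mem_gen2l : A \in G. Proof. by rewrite mem_gen ?inE ?eqxx. Qed.
Lemma mem_gen2r : B \in G. Proof. by rewrite mem_gen ?inE ?eqxx ?orbT. Qed.

(** With M = <c><a> and M' = <b><c>, the product M'M is stable under [A], which fixes [a] and sends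
    [b] into M' and [c] into M, and under [B] for the symmetric reason. *)
Lemma pi_core : exists X : {group gT},
  [/\ X :=: <[b]> * (<[c]> * <[a]>), X <| G & pi.-group X].
Proof.
have [hA hB] := hAB; have GA := mem_gen2l; have GB := mem_gen2r.
have cV : [~ B, A].`_pi = c^-1 by rewrite -consttV invg_comm.
have cVB' : commute ([~ B, A].`_pi) (B.`_pi^').
  by rewrite cV; apply/commute_sym/commuteV/commute_sym.
pose M := (<[c]> <*> <[a]>)%G; pose M' := (<[c]> <*> <[b]>)%G.
have defM : M = <[c]> * <[a]> :> {set gT} := cycle_constt_joing pi hA.
have defM' : M' = <[c]> * <[b]> :> {set gT}.
  by have := cycle_constt_joing pi hB; rewrite cV cycleV.
have defM'r : M' = <[b]> * <[c]> :> {set gT}.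
  have := cycle_constt_norm pi hB; rewrite cV cycleV defM' => /normC; exact.
have [Ma Mc] : a \in M /\ c \in M by rewrite !mem_gen ?inE ?cycle_id ?orbT.
have [M'b M'c] : b \in M' /\ c \in M' by rewrite !mem_gen ?inE ?cycle_id ?orbT.
pose X := M' * M; have defX : X = <[b]> * (<[c]> * <[a]>).
  by rewrite /X defM'r defM -!mulgA (mulgA <[c]>) mulGid.
have nXG : G \subset 'N(X).
  rewrite gen_subG subUset !sub1set !inE {1 3}defX !conjsMg -!cycleJ.
  have Xin (u v w : gT) : u \in M' -> v \in M' -> w \in M ->
      <[u]> * (<[v]> * <[w]>) \subset X.
    have -> : X = M' * (M' * M) by rewrite mulgA mulGid.
    by move=> *; rewrite !mulgSS ?cycle_subG.
  have Xin2 (u v w : gT) : u \in M' -> v \in M -> w \in M ->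
      <[u]> * (<[v]> * <[w]>) \subset X.
    have -> : X = M' * (M * M) by rewrite mulGid.
    by move=> *; rewrite !mulgSS ?cycle_subG.
  apply/andP; split.
    apply: Xin2; last by rewrite constt_conj.
      have := constt_conjr GB GA hB cVB'; rewrite cV => ->.
      exact: groupM (groupVr M'c) (groupX _ M'b).
    have -> := comm_constt_conjl cA'; exact: groupJ.
  apply: Xin; first by rewrite constt_conj.
    have := comm_constt_conjl cVB'; rewrite cV !conjVg => /invg_inj->; exact: groupJ M'c M'b.
  have -> := constt_conjr GA GB hA cA'; exact: groupM Mc (groupX _ Ma).
have GC : C \in G by rewrite groupR.
have cG x : x \in G -> x.`_pi \in G.
  by move=> Gx; rewrite (constt_exponent pi Gx) groupX.
have sMG : M \subset G by rewrite join_subG !cycle_subG !cG.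
have sM'G : M' \subset G by rewrite join_subG !cycle_subG !cG.
(* So far [X] is only a set. As M' normalises it, X M' = M' X = X, and hence [X] is closed under
   products. *)
have XM' : X * M' = X.
  by rewrite -(normC (subset_trans sM'G nXG)) mulgA mulGid.
have XX : X * X = X by rewrite {2}/X mulgA XM' /X -mulgA mulGid.
have gX : group_set X.
  by rewrite /group_set XX subxx andbT -[1]mulg1 mem_mulg.
exists (Group gX); split=> //=.
  by rewrite /normal nXG andbT mul_subG.
change (is_true (pi.-group (M' * M))); rewrite pgroupM (cycle_constt_joing_pgroup pi hA) andbT.
by have := cycle_constt_joing_pgroup pi hB; rewrite cV cycleV.
Qed.

End TwoSides.
End PiParts.
End PiCores.

(** * Congruences for the exponents modulo the primes dividing the orders of the generators *)

Section GoodPrimes.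
Lemma modn1_coprime_exp x i j d :
  0 < i -> coprime i j -> x ^ i = 1 %[mod d] -> x ^ j = 1 %[mod d] -> x = 1 %[mod d].
Proof.
move=> i_gt0 co xi xj; have [k1 k2 E _] := egcdnP j i_gt0.
have := modn1_exp k1 xi; rewrite -expnM mulnC E (eqP co) addn1 expnSr.
by rewrite -modnMml (mulnC k2) expnM (modn1_exp k2 xj) modnMml mul1n => ->.
Qed.

(** Modulo a prime power q^e the order of [x] is a power of [s]. If q < s it also divides q^(e-1) (q
    - 1), which is prime to [s]; if x = 1 modulo q it is also a power of q. Either way it is 1. *)
Lemma modn1_primes_exp s x j n : prime s -> 0 < n -> 0 < x ->
    x ^ (s ^ j) = 1 %[mod n] ->
    (forall q, prime q -> q %| n -> q != s -> q < s \/ x = 1 %[mod q]) ->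
  x = 1 %[mod n`_s^'].
Proof.
move=> s_pr n_gt0 x_gt0 xsj Hq; have s_gt0 := prime_gt0 s_pr.
apply/eqP; rewrite eqn_mod_dvd //; apply/dvdn_partP => // q.
rewrite pi_of_part // !inE => /andP[/= ].
rewrite mem_primes => /and3P[q_pr _ qn] qs'.
rewrite partn_part; last by move=> y; rewrite !inE => /eqP->.
rewrite -(eqn_mod_dvd _ x_gt0) p_part; set Q := (q ^ _)%N.
have Qn : Q %| n by rewrite /Q pfactor_dvdn.
have xsjQ : x ^ (s ^ j) = 1 %[mod Q].
  by rewrite -(modn_dvdm _ Qn) xsj modn_dvdm.
have co : coprime q s by rewrite prime_coprime // dvdn_prime2.
have e_gt0 : 0 < logn q n by rewrite logn_gt0 mem_primes q_pr n_gt0.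
apply/eqP; case: (Hq q q_pr qn) => // [q_lt|xq1].
  apply: (modn1_coprime_exp _ _ xsjQ (Euler_exp_totient _)); rewrite ?expn_gt0 ?s_gt0 //.
    rewrite coprimeXl // totient_pfactor // coprimeMr; apply/andP; split.
      rewrite prime_coprime // gtnNdvd //; first by rewrite -subn1 subn_gt0 prime_gt1.
      by apply: leq_trans q_lt; rewrite prednK ?prime_gt0.
    by rewrite coprime_sym coprimeXl.
  rewrite -(coprime_pexpl (k := s ^ j)) ?expn_gt0 ?s_gt0 //.
  by rewrite -coprime_modl xsjQ coprime_modl coprime1n.
have co2 : coprime (s ^ j) (q ^ logn q n).
  by rewrite coprimeXl // coprimeXr // coprime_sym.
apply: (modn1_coprime_exp _ co2 xsjQ); first by rewrite expn_gt0 s_gt0.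
have := modn1_exp_prime (logn q n).-1 x_gt0 xq1; rewrite prednK // => E.
by rewrite -{1}(prednK e_gt0) expnSr expnM modn1_exp.
Qed.
Local Open Scope group_scope.

Section Good.
Variable gT : finGroupType.
Implicit Types (A B C x z : gT).

Lemma modn_expg_order al x z n : x ^ z = x ^+ al -> z ^+ n = 1 ->
  al ^ n = 1 %[mod #[x]].
Proof.
move=> xz zn; apply/eqP; rewrite -eq_expg_mod_order expg1.
by have := conjg_expn 1 n xz; rewrite zn conjg1 expg1 mul1n => <-.
Qed.

Lemma commute_modn al x z : x ^ z = x ^+ al -> al = 1 %[mod #[x]] -> commute z x.
Proof.
move=> xz al1; apply/commute_sym/commgP/conjg_fixP; rewrite xz -[RHS]expg1.
by apply/eqP; rewrite eq_expg_mod_order al1.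
Qed.

Lemma constt_conj_exponent pi al x z : x ^ z = x ^+ al ->
  x ^ z.`_pi = x ^+ (al ^ pi_exponent pi #[z]).
Proof.
move=> xz; rewrite (constt_exponent (G := <[z]>%G) pi (cycle_id z)) -/#[z].
by have := conjg_expn 1 (pi_exponent pi #[z]) xz; rewrite expg1 mul1n.
Qed.

Lemma commute_constt_prime s al x z : prime s -> 0 < al -> x ^ z = x ^+ al ->
    (forall q, prime q -> q %| #[x] -> q != s -> q < s \/ al = 1 %[mod q]) ->
  commute (z.`_s) (x.`_s^').
Proof.
move=> s_pr al_gt0 xz Hq; have xc := constt_conj_exponent s xz.
set y := (al ^ _)%N in xc; apply: (commute_modn (conjg_constt s^' xc)).
rewrite order_constt.
have [j oz] := p_natP (p_elt_constt s z).
apply: (@modn1_primes_exp s y j) => //; first by rewrite expn_gt0 al_gt0.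
  by apply: (modn_expg_order xc); rewrite -oz expg_order.
move=> q q_pr qx qs; case: (Hq q) => // [|al1]; [by left | right].
exact: modn1_exp.
Qed.

(** When al = 1 modulo [p], the exponent of the action has p-power order modulo the p-part of
    [#[x]], whereas the acting element has order prime to [p]. *)
Lemma commute_constt_prime' p al x z : prime p -> 0 < al -> x ^ z = x ^+ al ->
    (p %| #[x] -> al = 1 %[mod p]) ->
  commute (z.`_p^') (x.`_p).
Proof.
move=> p_pr al_gt0 xz alp; have xc := constt_conj_exponent p^' xz.
set y := (al ^ _)%N in xc; apply: (commute_modn (conjg_constt p xc)).
rewrite order_constt p_part; have [->|e_gt0] := posnP (logn p #[x]).
  by rewrite expn0 !modn1.
have px : p %| #[x] by move: e_gt0; rewrite logn_gt0 mem_primes => /and3P[].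
have co : coprime (p ^ logn p #[x]) #[z.`_p^'].
  rewrite order_constt coprimeXl // coprime_sym.
  by apply: p'nat_coprime (part_pnat _ _) _; rewrite pnat_id.
apply: (modn1_coprime_exp _ (_ : coprime #[z.`_p^'] (p ^ logn p #[x]))) => //.
- by rewrite coprime_sym.
- have := modn_expg_order xc (expg_order _) => E.
  by rewrite -(modn_dvdm _ (_ : (p ^ logn p #[x])%N %| #[x])) ?pfactor_dvdnn //
    E modn_dvdm ?pfactor_dvdnn.
have y_gt0 : 0 < y by rewrite expn_gt0 al_gt0.
have := modn1_exp_prime (logn p #[x]).-1 y_gt0 (modn1_exp _ (alp px)).
rewrite prednK // => E.
by rewrite -{1}(prednK e_gt0) expnSr expnM modn1_exp.
Qed.

Section GoodPrime.
Variables (s al be : nat) (A B : gT).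
Hypotheses (s_pr : prime s) (hAB : Mrels al be A B) (al_gt0 : 0 < al).
Let G := <<[set A; B]>>%G.
Let C := [~ A, B].
Let a := A.`_s.
Let b := B.`_s.
Let c := C.`_s.
Hypothesis cA' : commute c (A.`_s^').
Hypothesis cB' : commute c (B.`_s^').

(** Since [r] is a multiple of the s'-part of [#[C]], the order of al^r modulo [s] divides a power
    of [s] and also s - 1, so al^r = 1. Then [s] divides (al - 1) [geom al r] but not al - 1. *)
Lemma bad_prime_exponent : s %| #[A] -> al <> 1 %[mod s] ->
  s %| geom al (pi_exponent s #|G|).
Proof.
move=> sA alN1; set r := pi_exponent _ _.
have GC : C \in G by rewrite groupR ?mem_gen2l ?mem_gen2r.
have E : al ^ r = 1 %[mod s].
  have oC := modn_expg_order hAB.1 (expg_order C).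
  have oCs : al ^ #[C] = 1 %[mod s] by rewrite -(modn_dvdm _ sA) oC modn_dvdm.
  have cal : coprime al s.
    rewrite -(coprime_pexpl (k := #[C])) ?order_gt0 //.
    by rewrite -coprime_modl oCs coprime_modl coprime1n.
  have /dvdnP[t rE] : #[C]`_s^' %| r.
    by apply: dvdn_trans (pi_exponent_modr _ _); rewrite partn_dvd ?order_dvdG.
  apply: (@modn1_coprime_exp _ #[C]`_s (totient s)) => //.
  - rewrite p_part coprimeXl // totient_prime // prime_coprime //.
    have [s1 s2] : 0 < s.-1 /\ s.-1 < s by case: (s) s_pr => [|[|n]].
    by rewrite gtnNdvd.
  - by rewrite -expnM rE -mulnA [X in (t * X)%N]mulnC partnC // mulnC expnM modn1_exp.
  by rewrite -expnM mulnC expnM modn1_exp // Euler_exp_totient.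
move: E alN1; rewrite -(prednK al_gt0) -geom_mul; set u := al.-1.
move=> /eqP; rewrite -[1%N in X in _ == X]add0n eqn_modDr mod0n -/(dvdn _ _) Euclid_dvdM //.
by case/orP=> // su []; rewrite -addn1 -modnDml (eqP su).
Qed.

(** Otherwise al - 1 is prime to [s]; working modulo the Frattini subgroup of X = <b><c><a> makes
    [X] equal to <b>, and then [a] is trivial. *)
Lemma good_prime : s %| #[A] -> al = 1 %[mod s].
Proof.
move=> sA; apply/eqP; apply: contraT => /eqP alN1; exfalso.
have := bad_prime_exponent sA alN1; set r := pi_exponent _ _ => sg.
have [hA hB] := hAB; have GA : A \in G := mem_gen2l A B; have GB : B \in G := mem_gen2r A B.
have GC : C \in G by rewrite groupR.
have cV : [~ B, A].`_s = c^-1 by rewrite -consttV invg_comm.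
have cVB' : commute ([~ B, A].`_s) (B.`_s^').
  by rewrite cV; apply/commute_sym/commuteV/commute_sym.
have [X [defX nXG sX]] := pi_core hAB cA' cB'.
set k := (al * geom al r)%N; have sk : s %| k by rewrite dvdn_mull.
have aB : a ^ B = c * a ^+ k := constt_conjr GA GB hA cA'.
have cB : c ^ B = c * [~ c, b].
  rewrite commgEl mulKVg; apply/invg_inj; rewrite -!conjVg -cV.
  exact: comm_constt_conjl cVB'.
have [Xa Xb Xc] : [/\ a \in X, b \in X & c \in X].
  rewrite defX; split; last first.
  - by rewrite -[c]mul1g mem_mulg // -[c]mulg1 mem_mulg ?cycle_id.
  - by rewrite -[b]mulg1 mem_mulg ?cycle_id // -[1]mulg1 mem_mulg.
  by rewrite -[a]mul1g mem_mulg // -[a]mul1g mem_mulg ?cycle_id.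
have sa : s.-elt a := p_elt_constt s A.
have PhiX := Phi_joing sX.
have Phi_s x : x \in X -> x ^+ s \in 'Phi(X).
  move=> Xx; rewrite PhiX mem_gen // inE -[s in _ ^+ s]expn1.
  by rewrite (Mho_p_elt 1 Xx (mem_p_elt sX Xx)) orbT.
have Phi_der x y : x \in X -> y \in X -> [~ x, y] \in 'Phi(X).
  by move=> Xx Xy; rewrite PhiX mem_gen // inE mem_commg.
have nPhi : G \subset 'N('Phi(X)).
  exact/normal_norm/(char_normal_trans (Phi_char X)).
have ak : a ^+ k \in 'Phi(X).
  by case/dvdnP: sk => j ->; rewrite mulnC expgnA groupX ?Phi_s.
(* Its conjugate by [B] is a^-k [c, b], both factors of which lie in the Frattini subgroup. *)
have ac : a^-1 * c \in 'Phi(X).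
  rewrite -(memJ_norm _ (subsetP nPhi _ GB)) conjMg conjVg aB cB invMg.
  by rewrite -!mulgA mulKg groupM ?groupV ?Phi_der.
have aC : a ^ C = a ^+ al := conjg_constt s hA.
have cC : c ^ C = c := constt_conj s C.
have ac' : a ^- al * c \in 'Phi(X).
  have <- : (a^-1 * c) ^ C = a ^- al * c by rewrite conjMg conjVg aC cC.
  by rewrite memJ_norm // (subsetP nPhi).
have alE : a ^+ al = a * a ^+ al.-1 by rewrite -expgS prednK.
have ay : a ^+ al.-1 \in 'Phi(X).
  have := groupM ac (groupVr ac'); rewrite invMg invgK !mulgA mulgK alE.
  by rewrite mulKg.
have genA : <[a]> = <[a ^+ al.-1]>.
  apply/eqP; rewrite -/(generator _ _) generator_coprime order_constt p_part.
  rewrite coprimeXl // prime_coprime //; apply: contra_notN alN1 => sal.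
  by rewrite -(prednK al_gt0) -addn1 -modnDml (eqP sal).
have Pa : a \in 'Phi(X).
  by rewrite -cycle_subG genA cycle_subG.
have Pc : c \in 'Phi(X) by rewrite -(groupMl _ (groupVr Pa)).
have Xb_gen : X = <[b]> :> {set gT}.
  symmetry; apply: Phi_nongen; apply/eqP; rewrite eqEsubset join_subG.
  rewrite Phi_sub sub1set Xb /= {1}defX !mul_subG //; last first.
  - by rewrite cycle_subG mem_gen // inE Pa.
  - by rewrite cycle_subG mem_gen // inE Pc.
  by rewrite cycle_subG mem_gen // inE set11 orbT.
have aB1 : a ^ B = a.
  apply: commute_conjg; apply: (centsP (cycle_abelian B)); rewrite ?cycle_id //.
  by move: Xa; rewrite Xb_gen; apply: subsetP; rewrite cycle_subG cycle_constt.
rewrite aB1 in aB.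
(* Divide the conjugate by [C] of the relation a = c a^k by the relation itself. As [s] divides [k],
   only the trivial s-element can equal its own k-th power. *)
have E : a ^+ al.-1 = (a ^+ al.-1) ^+ k.
  have : a ^ C = (c * a ^+ k) ^ C by rewrite -aB.
  rewrite conjMg (conjXg a) cC aC -(expgnA a) => E.
  apply: (mulgI a); rewrite -alE E {2}aB -mulgA -!(expgnA a) -expgD.
  by rewrite -mulSn prednK.
have y1 : a ^+ al.-1 = 1.
  apply/eqP; rewrite -order_eq1; have [j oy] := p_natP (mem_p_elt sX (groupX al.-1 Xa)).
  rewrite oy; case: j oy => // j oy.
  have : k == 1 %[mod #[a ^+ al.-1]] by rewrite -eq_expg_mod_order -E expg1.
  rewrite oy => /eqP/(congr1 (modn^~ s)); rewrite !modn_dvdm ?expnS ?dvdn_mulr //.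
  by rewrite (eqP sk) modn_small ?prime_gt1.
have : a = 1 by apply/eqP; rewrite -cycle_eq1 genA y1 cycle1.
move/eqP; rewrite -order_eq1 order_constt p_part_eq1 mem_primes s_pr order_gt0.
by rewrite sA.
Qed.
End GoodPrime.
End Good.
End GoodPrimes.

(** * Splitting of the group into its p-part and its p'-part *)

Section DirectFactors.
Local Open Scope group_scope.

Section Splitting.
Variables (gT : finGroupType) (al be : nat) (A B : gT).
Hypotheses (hAB : Mrels al be A B) (al_gt0 : 0 < al) (be_gt0 : 0 < be).

Lemma commute_swap pi x : commute [~ B, A].`_pi x -> commute [~ A, B].`_pi x.
Proof.
by rewrite -invg_comm consttV => /commute_sym/commuteV/commute_sym; rewrite invgK.
Qed.

Lemma commute_swapV pi x : commute [~ A, B].`_pi x -> commute [~ B, A].`_pi x.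
Proof.
by rewrite -[[~ B, A]]invg_comm consttV => /commute_sym/commuteV/commute_sym.
Qed.

(** Descending induction on [q]: primes above [#[A] * #[B]] divide neither order, and the
    congruences at the primes above [q] supply the commutation hypotheses of [good_prime] at [q]. *)
Lemma all_good q : prime q ->
  (q %| #[A] -> al = 1 %[mod q]) /\ (q %| #[B] -> be = 1 %[mod q]).
Proof.
have [n] := ubnP (#[A] * #[B] - q); elim: n q => // n IHn q le_n q_pr.
have [hA hB] := hAB.
have H r : prime r -> q < r -> 
    (r %| #[A] -> al = 1 %[mod r]) /\ (r %| #[B] -> be = 1 %[mod r]).
  move=> r_pr qr; have [le|gt] := leqP r (#[A] * #[B]).
    by apply: IHn => //; lia.
  have oA := order_gt0 A; have oB := order_gt0 B.
  by split=> /dvdn_leq le; exfalso; have := le (order_gt0 _); nia.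
have cA : commute ([~ A, B].`_q) (A.`_q^').
  apply: (commute_constt_prime q_pr al_gt0 hA) => r r_pr rA rq.
  by case: (ltngtP r q) rq => // qr _; [left | right; apply: (H r r_pr qr).1].
have cB : commute ([~ A, B].`_q) (B.`_q^').
  apply/commute_swap/(commute_constt_prime q_pr be_gt0 hB) => r r_pr rA rq.
  by case: (ltngtP r q) rq => // qr _; [left | right; apply: (H r r_pr qr).2].
split; first exact: (good_prime q_pr hAB).
exact: (good_prime q_pr (Mrels_sym hAB) be_gt0 (commute_swapV cB) (commute_swapV cA)).
Qed.

(** The factors are the cores for p and p'. Being normal of coprime orders they commute elementwise,
    so commutators and conjugations are computed in each factor separately. *)
Lemma Mrels_splitting p : prime p -> exists P K : {group gT},
  [/\ P \x K = <<[set A; B]>>, p.-group P, p^'.-group K,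
      P :=: <[B.`_p]> * (<[[~ A, B].`_p]> * <[A.`_p]>) &
      [~ A.`_p, B.`_p] = [~ A, B].`_p /\ Mrels al be A.`_p B.`_p].
Proof.
move=> p_pr; have [hA hB] := hAB.
have cA : commute ([~ A, B].`_p) (A.`_p^').
  apply: (commute_constt_prime p_pr al_gt0 hA) => r r_pr rA rq.
  by right; apply: (all_good r_pr).1.
have cB : commute ([~ A, B].`_p) (B.`_p^').
  apply/commute_swap/(commute_constt_prime p_pr be_gt0 hB) => r r_pr rA rq.
  by right; apply: (all_good r_pr).2.
have cA' : commute ([~ A, B].`_p^') (A.`_p^'^').
  rewrite consttNK; exact: (commute_constt_prime' p_pr al_gt0 hA (all_good p_pr).1).
have cB' : commute ([~ A, B].`_p^') (B.`_p^'^').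
  rewrite consttNK; apply/commute_swap.
  exact: (commute_constt_prime' p_pr be_gt0 hB (all_good p_pr).2).
have [P [defP nP pP]] := pi_core hAB cA cB.
have [K [defK nK p'K]] := pi_core hAB cA' cB'.
have inXA pi (X : {group gT}) : X :=: <[B.`_pi]> * (<[[~ A, B].`_pi]> * <[A.`_pi]>) ->
    [/\ A.`_pi \in X, B.`_pi \in X & [~ A, B].`_pi \in X].
  move=> ->; split; last first.
  - by rewrite -[X in X \in _]mul1g mem_mulg // -[X in X \in _]mulg1 mem_mulg ?cycle_id.
  - by rewrite -[X in X \in _]mulg1 mem_mulg ?cycle_id // -[1]mulg1 mem_mulg.
  by rewrite -[X in X \in _]mul1g mem_mulg // -[X in X \in _]mul1g mem_mulg ?cycle_id.
have [Pa Pb Pc] := inXA _ _ defP; have [Ka Kb Kc] := inXA _ _ defK.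
have tiPK : P :&: K = 1 by apply: coprime_TIg; apply: pnat_coprime pP p'K.
have cPK : K \subset 'C(P).
  rewrite centsC; apply/commG1P/trivgP; rewrite -tiPK commg_subI // subsetI subxx.
    exact: subset_trans (normal_sub nP) (normal_norm nK).
  exact: subset_trans (normal_sub nK) (normal_norm nP).
have PK : P \x K = <<[set A; B]>>.
  rewrite dprodE //; apply/eqP; rewrite eqEsubset (mul_subG (normal_sub nP) (normal_sub nK)) /=.
  rewrite -norm_joinEr ?(subset_trans (normal_sub nK) (normal_norm nP)) //.
  rewrite gen_subG subUset !sub1set -{1}(consttC p A) -{1}(consttC p B).
  by rewrite !groupM // mem_gen // inE ?Pa ?Pb ?Ka ?Kb ?orbT.
have com x y : x \in P -> y \in K -> commute x y.
  by move=> Px Ky; apply/commute_sym; apply: (centsP cPK).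
have c_ab : [~ A.`_p, B.`_p] = [~ A, B].`_p.
  have Kab : [~ A.`_p^', B.`_p^'] \in K by rewrite groupR.
  have Pab : [~ A.`_p, B.`_p] \in P by rewrite groupR.
  have E x y u v : x \in P -> y \in P -> u \in K -> v \in K ->
      [~ x * u, y * v] = [~ x, y] * [~ u, v].
    move=> Px Py Ku Kv; rewrite commgEl conjMg !conjgM.
    rewrite (commute_conjg (com _ _ (groupJ Px Py) Kv)).
    rewrite (commute_conjg (commute_sym (com _ _ Py Ku))) invMg.
    have cm : u^-1 * [~ x, y] = [~ x, y] * u^-1.
      by symmetry; apply: com; rewrite ?groupV // groupR.
    by rewrite -(mulgA u^-1) (mulgA x^-1) -commgEl (mulgA u^-1) cm -mulgA -commgEl.
  have -> : [~ A, B] = [~ A.`_p, B.`_p] * [~ A.`_p^', B.`_p^'].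
    by rewrite -E // !consttC.
  rewrite consttM; last exact: com.
  have -> : [~ A.`_p^', B.`_p^'].`_p = 1 by apply/constt1P/(mem_p_elt p'K Kab).
  by rewrite mulg1 (constt_p_elt (mem_p_elt pP Pab)).
exists P, K; split=> //; split=> //.
rewrite /Mrels -{1}[[~ B.`_p, _]]invg_comm c_ab.
have JC x g : x \in P -> g.`_p \in P -> g.`_p^' \in K -> x ^ g.`_p = x ^ g.
  move=> Px Pg Kg; rewrite -[in RHS](consttC p g) conjgM.
  by rewrite (commute_conjg (com _ _ (groupJ Px Pg) Kg)).
rewrite -consttV invg_comm !JC -?[[~ B, A]]invg_comm ?consttV ?groupV //.
by rewrite invg_comm (conjg_constt p hA) (conjg_constt p hB).
Qed.
End Splitting.
End DirectFactors.

(** * Valuations *)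

Section PadicValuations.
Lemma bin2_eq n : 2 * 'C(n, 2) + n = n ^ 2.
Proof. by elim: n => // n IHn; rewrite binS bin1; nia. Qed.

Lemma bin3_eq n : 6 * 'C(n, 3) + 3 * n ^ 2 = n ^ 3 + 2 * n.
Proof.
elim: n => // n IHn; rewrite binS; have := bin2_eq n.
rewrite !expnS !expn0 !muln1 in IHn *; nia.
Qed.

Section Valuations.
Variable p : nat.
Hypotheses (p_pr : prime p) (p_gt2 : 2 < p).

Lemma logn_eqP n e : 0 < n -> p ^ e %| n -> ~~ (p ^ e.+1 %| n) -> logn p n = e.
Proof.
by move=> n0; rewrite !pfactor_dvdn // -ltnNge => ? ?; apply/eqP; rewrite eqn_leq -ltnS; apply/andP.
Qed.

Lemma logn_eq_dvd x y e : 0 < y -> logn p y = e ->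
    (forall k, k <= e.+1 -> (p ^ k %| x) = (p ^ k %| y)) ->
  0 < x /\ logn p x = e.
Proof.
move=> y0 ye H; have He := H e (leqnSn _); have HSe := H e.+1 (leqnn _).
rewrite !(pfactor_dvdn _ _ y0) // ye leqnn ltnn in He HSe.
have x0 : 0 < x by move: HSe; case: (x) => //; rewrite dvdn0.
by split=> //; apply: logn_eqP; rewrite ?He ?HSe.
Qed.

Lemma logn_eq_mod x y e f : 0 < y -> logn p y = e -> e < f ->
  x = y %[mod p ^ f] -> 0 < x /\ logn p x = e.
Proof.
move=> y0 ye ef xy; apply: (logn_eq_dvd y0 ye) => k ke.
have kf : p ^ k %| p ^ f by rewrite dvdn_exp2l // (leq_trans ke).
by rewrite /dvdn -(modn_dvdm x kf) xy modn_dvdm.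
Qed.

Lemma logn_addl x y e : 0 < x -> logn p x = e -> p ^ e.+1 %| y -> logn p (x + y) = e.
Proof.
move=> x0 xe ye; apply: (logn_eq_dvd x0 xe _).2 => k ke.
by rewrite dvdn_addl // (dvdn_trans _ ye) // dvdn_exp2l.
Qed.

Lemma coprime_p2 k : coprime (p ^ k) 2.
Proof. by rewrite coprimeXl // prime_coprime // gtnNdvd. Qed.

Lemma pexp_dvd_bin2 k n : p ^ k %| n -> p ^ k %| 'C(n, 2).
Proof.
move=> pn; rewrite -(Gauss_dvdr _ (coprime_p2 k)) -(dvdn_addl _ pn) bin2_eq.
by rewrite expnS dvdn_mulr.
Qed.

(** The spare power of [p] pays for the factor 3 of 6 when p = 3. *)
Lemma pexp_dvd_bin3 k n : p ^ k.+1 %| n -> p ^ k %| 'C(n, 3).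
Proof.
move=> pn; have pn2 : p ^ k.+1 %| 3 * n ^ 2 by rewrite dvdn_mull // (expnS n) dvdn_mulr.
have : p ^ k.+1 %| 6 * 'C(n, 3).
  by rewrite -(dvdn_addl _ pn2) bin3_eq dvdn_add //;
    [rewrite (expnS n) dvdn_mulr | rewrite dvdn_mull].
rewrite (_ : 6 = 2 * 3) // -mulnA (Gauss_dvdr _ (coprime_p2 _)).
have [->|p3] := eqVneq p 3; first by rewrite expnS dvdn_pmul2l.
rewrite Gauss_dvdr; first by apply: dvdn_trans; rewrite dvdn_exp2l.
by rewrite coprimeXl // prime_coprime // dvdn_prime2.
Qed.

(** Beyond [n], every term of [geom_expansion] vanishes: the second factor [u] of the cubic binomial
    term covers the loss at p = 3, and k <= 2m disposes of the remainder [u ^ 3 * e]. *)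
Lemma geom_modp m k u n : 0 < m -> k <= 2 * m -> p ^ m %| u -> p ^ k %| n ->
  geom u.+1 n = n %[mod p ^ (m + k)].
Proof.
move=> m0 km pu pn; have [e ->] := geom_expansion u n.
have d1 : p ^ (m + k) %| u * 'C(n, 2).
  by rewrite expnD dvdn_mul // pexp_dvd_bin2.
have d2 : p ^ (m + k) %| u ^ 2 * 'C(n, 3).
  case: k km pn {d1} => [|k] km pn.
    by rewrite addn0 dvdn_mulr // expnS dvdn_mulr.
  have -> : m + k.+1 = m * 2 + k - (m - 1) by lia.
  apply: dvdn_trans (_ : p ^ (m * 2 + k) %| _); first by rewrite dvdn_exp2l // leq_subr.
  by rewrite expnD dvdn_mul ?expnM ?dvdn_exp2r // pexp_dvd_bin3.
have d3 : p ^ (m + k) %| u ^ 3 * e.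
  rewrite dvdn_mulr //; apply: dvdn_trans (_ : p ^ (m * 3) %| _).
    by rewrite dvdn_exp2l //; lia.
  by rewrite expnM dvdn_exp2r.
rewrite -!addnA; apply/eqP; rewrite -[X in _ == X %[mod _]]addn0 eqn_modDl.
by rewrite mod0n -/(dvdn _ _) !dvdn_add.
Qed.

(** In other words the gap is u^2 / 2 up to terms in u^3; clearing denominators and using two
    remainders keeps the identity inside the naturals. *)
Lemma gap_eq u : exists s t, 6 * gap u.+1 + u ^ 3 * s = 3 * u ^ 2 + u ^ 3 * t.
Proof.
have [e fE] := geom_expansion u u; set f := geom u.+1 u in fE.
have gE : gap u.+1 + f = u + u ^ 2 * f.
  have := subnK (geom_le_exp u.+1); rewrite -/(gap _) geomS -/f.
  have := geom_mul u u.+1; rewrite geomS -/f => <-.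
  by rewrite mulnDr; nia.
have c2 := bin2_eq u; have c3 := bin3_eq u.
exists (u ^ 2 + 5 + 6 * e), (6 * (1 + 'C(u, 2) + u * 'C(u, 3) + u ^ 2 * e) + 3 * u).
move: c2 c3 fE; set x := 'C(u, 2); set y := 'C(u, 3) => c2 c3 fE.
have h2 := congr1 (muln (3 * u)) c2; have h3 := congr1 (muln (u ^ 2)) c3.
have hf := congr1 (muln (u ^ 2)) fE.
rewrite !expnS !expn0 !muln1 in gE fE h2 h3 hf *.
nia.
Qed.

(** The terms in u^3 have valuation at least 3m, which exceeds that of 3 u^2 even for p = 3 because
    m > 1. *)
Lemma logn_gap m al : 1 < m -> logn p (al - 1) = m ->
  0 < gap al /\ logn p (gap al) = 2 * m.
Proof.
case: al => [|u]; first by rewrite logn0 => + m0; rewrite -m0.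
rewrite subn1 => m1 um; have [s [t E]] := gap_eq u.
have u0 : 0 < u by case: (u) um m1 => // <-; rewrite logn0.
have p2 : logn p 2 = 0.
  by apply/eqP; rewrite -leqn0 leqNgt logn_gt0 mem_primes p_pr /= gtnNdvd.
have p3 : logn p 3 <= 1.
  have [->|pn3] := eqVneq p 3; first by rewrite (pfactorK 1).
  rewrite (_ : logn p 3 = 0) //; apply/eqP; rewrite -leqn0 leqNgt logn_gt0.
  by rewrite mem_primes p_pr /= dvdn_prime2 // (negPf pn3).
have e3 : logn p (3 * u ^ 2) = logn p 3 + 2 * m by rewrite lognM ?expn_gt0 ?u0 // lognX um.
have [|k km|L0] := @logn_eq_dvd (6 * gap u.+1) (3 * u ^ 2) _ _ e3.
- by rewrite muln_gt0 expn_gt0 u0.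
- have pu3 x : p ^ k %| u ^ 3 * x.
    rewrite dvdn_mulr // pfactor_dvdn ?expn_gt0 ?u0 // lognX um; lia.
  by rewrite -(dvdn_addl _ (pu3 s)) E dvdn_addl.
have g0 : 0 < gap u.+1 by move: L0; rewrite muln_gt0.
by rewrite (_ : 6 = 2 * 3) // !lognM // p2 => /addnI.
Qed.
End Valuations.
End PadicValuations.

(** * Upper bounds *)

Section OrderRelations.
Local Open Scope group_scope.

Lemma geom_ge x n : 0 < x -> n <= geom x n.
Proof.
move=> x0; elim: n => // n IHn; rewrite geomSr -addn1 leq_add //.
by rewrite expn_gt0 x0.
Qed.

Lemma cycle_expg_logn (gT : finGroupType) (p : nat) (x : gT) n k :
  prime p -> p.-elt x -> 0 < n -> logn p n = k -> <[x ^+ n]> = <[x ^+ (p ^ k)]>.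
Proof.
move=> p_pr px n0 <-; have [n' co nE] := pfactor_coprime p_pr n0.
rewrite {1}nE mulnC expgnA.
apply/esym/eqP; rewrite -/(generator _ _) generator_coprime.
by have [j ->] := p_natP (p_eltX (p ^ logn p n) px); rewrite coprimeXl.
Qed.

Section OrderBounds.
Variables (gT : finGroupType) (p al be m l : nat) (a b : gT).
Hypotheses (p_pr : prime p) (p_gt2 : 2 < p) (hab : Mrels al be a b).
Hypotheses (pa : p.-elt a) (pb : p.-elt b) (pc : p.-elt [~ a, b]).
Hypotheses (al_gt1 : 1 < al) (be_gt1 : 1 < be).
Hypotheses (al_m : logn p (al - 1) = m) (be_m : logn p (be - 1) = m).
Hypotheses (ml : m < l) (lm : 2 * l < 3 * m).
Let c := [~ a, b].

Section Positive.
Variable dl : nat.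
Hypotheses (al_be : al = be + dl) (dl_l : logn p dl = l).

Let dl_gt0 : 0 < dl.
Proof. by case: (dl) dl_l ml => // <-; rewrite logn0. Qed.

Let pal : p ^ m %| al - 1. Proof. by rewrite -al_m pfactor_dvdnn. Qed.
Let pbe : p ^ m %| be - 1. Proof. by rewrite -be_m pfactor_dvdnn. Qed.

(** Move c^be to the left in [expg_relator]; this multiplies the exponent of [b] by a power of [be],
    which is prime to [p]. *)
Lemma first_relator : exists2 Z, 0 < Z /\ logn p Z = (2 * m)%N &
  b ^+ Z * a ^+ gap al = c ^+ dl.
Proof.
have [hA hB] := hab; rewrite -invg_comm -/c in hB.
have [g0 glog] : 0 < gap be /\ logn p (gap be) = (2 * m)%N.
  by apply: logn_gap be_m => //; lia.
have co_be : logn p be = 0.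
  apply/eqP; rewrite -leqn0 leqNgt logn_gt0 mem_primes p_pr (ltnW be_gt1) /=.
  have pu : p %| be - 1 by apply: dvdn_trans pbe; rewrite dvdn_exp //; lia.
  apply/negP=> pbe'; have := dvdn_sub pbe' pu.
  by rewrite subKn ?(ltnW be_gt1) // dvdn1 => /eqP p1; move: p_gt2; rewrite p1.
(* [n] is a natural number standing for -be modulo [#[c]]. *)
pose n := (be * (#[c] - 1))%N; exists (be * gap be * be ^ n)%N.
  rewrite !muln_gt0 expn_gt0 g0 (ltnW be_gt1); split=> //.
  by rewrite !lognM ?muln_gt0 ?expn_gt0 ?g0 ?(ltnW be_gt1) // lognX co_be glog muln0 addn0.
have cE : c ^+ be = c^-1 ^+ n.
  rewrite expgVn; apply/eqP; rewrite eq_sym eq_invg_mul -expgD addnC /n -mulnS.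
  by rewrite subn1 prednK ?order_gt0 // mulnC expgnA expg_order expg1n.
rewrite -(conjg_expn _ n hB) -cE conjgE; apply: (mulgI (c ^+ be)).
by rewrite -expgD -al_be -(expg_relator hab) !mulgA mulgV mul1g.
Qed.

(** Conjugate the first relation by [b]. The right side gains b^n with n = be^dl - 1, and on the
    left a^Y becomes c^Y a^(Y + j). *)
Lemma second_relator : exists n j,
  [/\ 0 < n, logn p n = (m + l)%N, p ^ (3 * m) %| j &
      b ^+ n = c ^+ gap al * a ^+ j].
Proof.
have [hA hB] := hab; rewrite -invg_comm -/c in hB.
have [Z _ R0] := first_relator.
set Y := gap al in R0 *; have [Y0 Ylog] : 0 < Y /\ logn p Y = (2 * m)%N.
  by apply: logn_gap al_m => //; lia.
pose n := ((be - 1) * geom be dl)%N.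
have nE : (be ^ dl = n.+1)%N.
  have beE : be = (be - 1).+1 by lia.
  by rewrite {1}beE -geom_mul -beE addn1.
pose j := (al * geom al Y - Y)%N.
have wE : (al * geom al Y = Y + j)%N.
  rewrite /j subnKC //; apply: leq_trans (geom_ge _ _) (leq_pmull _ _); lia.
have [lg0 lg] : 0 < geom be dl /\ logn p (geom be dl) = l.
  apply: (logn_eq_mod p_pr dl_gt0 dl_l (_ : l < m + l)); first by lia.
  rewrite (_ : be = (be - 1).+1); last by lia.
  apply: geom_modp => //; [lia | lia | by rewrite -dl_l pfactor_dvdnn].
exists n, j; split.
- by rewrite muln_gt0 lg0 andbT; lia.
- by rewrite lognM // ?lg ?be_m // subn_gt0.
- have m3 : (3 * m = m + 2 * m)%N by lia.
  have Yd : p ^ (2 * m) %| Y by rewrite -Ylog pfactor_dvdnn.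
  have gY : geom al Y = Y %[mod p ^ (3 * m)].
    by rewrite {1}(_ : al = (al - 1).+1) ?m3; [apply: geom_modp => //; lia | lia].
  have aY : p ^ (3 * m) %| (al - 1) * Y by rewrite m3 expnD dvdn_mul.
  rewrite -eqn_mod_dvd ?wE ?leq_addr // -wE -modnMmr gY modnMmr.
  by rewrite eqn_mod_dvd ?leq_pmull ?(ltnW al_gt1) // -{2}[Y]mul1n -mulnBl.
have cb : (c ^+ dl) ^ b = b ^+ n * c ^+ dl.
  apply: invg_inj; rewrite -conjVg -expgVn (expg_conjg _ hB) nE expgS.
  by rewrite (invMg b) (invMg (b ^+ n)) (expgVn c) mulgA mulgKV.
have bZ : (b ^+ Z) ^ b = b ^+ Z by exact/commute_conjg/commute_sym/commuteX.
have E : b ^+ Z * (a ^+ Y) ^ b = b ^+ n * (b ^+ Z * a ^+ Y).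
  by rewrite R0 -cb -R0 conjMg bZ.
move: E; rewrite (mulgA (b ^+ n)) -expgD addnC expgD -mulgA => /mulgI.
rewrite (conjgX_geom Y hA) -/c wE addnC expgD mulgA.
by move/mulIg/esym.
Qed.

(** Raise the two relations to powers with the same power of [b] and equate: this gives c^(dl r - Y
    Z') = a^(Y S + j S'), where the first terms have valuations 2l - m and m + l and the other terms
    have larger ones. *)
Lemma cycle_comm_eq_cycle :
  <[c ^+ (p ^ (2 * l - m))]> = <[a ^+ (p ^ (m + l))]>.
Proof.
have [e1 e2 e3] : [/\ l + (l - m) = 2 * l - m, 2 * m + (l - m) = m + l &
    l - m < m]%N by split; move: ml lm; clear; lia.
have [e4 e5] : (2 * l - m < 2 * m)%N /\ (m + l < 3 * m)%N.
  by split; move: ml lm; clear; lia.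
have [Z [Z0 Zlog] R0] := first_relator.
have [n [j [n0 nlog jdvd R1]]] := second_relator.
set Y := gap al in R0 R1 *; have [Y0 Ylog] : 0 < Y /\ logn p Y = (2 * m)%N.
  by apply: logn_gap al_m => //; lia.
have /dvdnP[Z' ZE] : p ^ (2 * m) %| Z by rewrite -Zlog pfactor_dvdnn.
have /dvdnP[n' nE] : p ^ (m + l) %| n by rewrite -nlog pfactor_dvdnn.
have pgt0 k : 0 < p ^ k by rewrite expn_gt0 prime_gt0.
have [Z'0 n'0] : 0 < Z' /\ 0 < n'.
  by move: Z0 n0; rewrite ZE nE !muln_gt0 => /andP[-> _] /andP[-> _].
have n'log : logn p n' = 0.
  by move: nlog; rewrite nE lognM // pfactorK // -[RHS]add0n => /addIn.
(* Chosen so that Z r = n Z', the common exponent of [b]. *)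
pose r := (p ^ (l - m) * n')%N.
have r0 : 0 < r by rewrite muln_gt0 pgt0.
have rlog : logn p r = (l - m)%N by rewrite lognM // pfactorK // n'log addn0.
have Zr : (Z * r = n * Z')%N.
  by rewrite ZE nE /r -e2 expnD; ring.
have hA : a ^ c = a ^+ al := hab.1.
have hA' : a^-1 ^ c = a^-1 ^+ al by rewrite conjVg hA expgVn.
have E : c ^+ (dl * r) * a^-1 ^+ (Y * geom (al ^ dl) r) =
         c ^+ (Y * Z') * a ^+ (j * geom (al ^ Y) Z').
  rewrite -(expgM_geom _ _ _ hA') -(expgM_geom _ _ _ hA) -R1 -expgnA -Zr expgnA.
  by congr (_ ^+ r); rewrite -R0 expgVn mulgK.
set S := geom _ r in E; set S' := geom _ Z' in E.
have [S0 Slog] : 0 < S /\ logn p S = (l - m)%N.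
  apply: (logn_eq_mod p_pr r0 rlog e3).
  apply/geom_modn/modn1_exp/eqP; rewrite eqn_mod_dvd //; exact: ltnW.
have E2 : c ^+ (dl * r + Y * Z' * (#[c] - 1)) = a ^+ (Y * S + j * S').
  have -> : a ^+ (Y * S + j * S') = c ^- (Y * Z') * c ^+ (dl * r).
    apply: (mulgI (c ^+ (Y * Z'))); rewrite mulKVg addnC expgD mulgA -E.
    by rewrite -mulgA expgVn mulVg mulg1.
  rewrite addnC expgD; congr (_ * _); apply/eqP.
  rewrite eq_sym eq_invg_mul -expgD -mulnS subn1 prednK ?order_gt0 //.
  by rewrite mulnC expgnA expg_order expg1n.
have dlr : 0 < dl * r by rewrite muln_gt0 dl_gt0.
have YS : 0 < Y * S by rewrite muln_gt0 Y0.
rewrite -(cycle_expg_logn p_pr pc (_ : 0 < dl * r + Y * Z' * (#[c] - 1))); last first.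
- apply: logn_addl => //; first by rewrite lognM // dl_l rlog.
  rewrite -mulnA dvdn_mulr // (dvdn_trans _ (_ : p ^ (2 * m) %| _)) ?dvdn_exp2l //.
  by rewrite -Ylog pfactor_dvdnn.
- by rewrite ltn_addr.
rewrite -(cycle_expg_logn p_pr pa (_ : 0 < Y * S + j * S')) ?E2 //.
  by rewrite ltn_addr.
apply: logn_addl => //; first by rewrite lognM // Ylog Slog.
by rewrite dvdn_mulr // (dvdn_trans _ jdvd) // dvdn_exp2l.
Qed.
End Positive.
End OrderBounds.
End OrderRelations.

(** * Upper bounds for the orders of the generators, the class and the order of the Sylow
    subgroup *)

Section SylowUpperBounds.
Local Open Scope group_scope.

Section UpperBounds.
(* be and be' represent beta on either side of al, as cycle_comm_eq_cycle needs a positive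
   difference. *)
Variables (gT : finGroupType) (p al be be' dl dl' m l : nat) (a b : gT).
Hypotheses (p_pr : prime p) (p_gt2 : 2 < p).
Hypotheses (hab : Mrels al be a b) (hab' : Mrels al be' a b).
Hypotheses (pa : p.-elt a) (pb : p.-elt b) (pc : p.-elt [~ a, b]).
Hypotheses (be_gt1 : 1 < be) (al_be : al = be + dl) (be'_al : be' = al + dl').
Hypotheses (al_m : logn p (al - 1) = m) (be_m : logn p (be - 1) = m).
Hypotheses (be'_m : logn p (be' - 1) = m).
Hypotheses (dl_l : logn p dl = l) (dl'_l : logn p dl' = l).
Hypotheses (ml : m < l) (lm : 2 * l < 3 * m).
Let c := [~ a, b].

Lemma cycle_comm_eq_cycle_r : <[c ^+ (p ^ (2 * l - m))]> = <[b ^+ (p ^ (m + l))]>.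
Proof.
have al1 : 1 < al by lia.
have be'1 : 1 < be' by lia.
have pc' : p.-elt [~ b, a] by rewrite -invg_comm p_eltV.
rewrite -(cycle_comm_eq_cycle p_pr p_gt2 (Mrels_sym hab') pb pa pc' be'1 al1
  be'_m al_m ml lm be'_al dl'_l).
by rewrite -invg_comm expgVn cycleV.
Qed.

(** The powers of [a], [b] and [c] generate one cyclic group <g>. In b^n = c^Y a^j the left side
    generates <g>, while the right side lies in <g^p> because 2m > 2l - m and 3m > m + l; hence g =
    1. *)
Lemma order_bounds :
  [/\ a ^+ (p ^ (m + l)) = 1, b ^+ (p ^ (m + l)) = 1 & c ^+ (p ^ (2 * l - m)) = 1].
Proof.
have al1 : 1 < al by lia.
have ca := cycle_comm_eq_cycle p_pr p_gt2 hab pa pb pc al1 be_gt1 al_m be_m ml lm al_be dl_l.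
have cb := cycle_comm_eq_cycle_r.
have [n [j [n0 nlog jd R1]]] := second_relator p_pr p_gt2 hab pa pb pc al1 be_gt1
  al_m be_m ml lm al_be dl_l.
have [Y0 Ylog] : 0 < gap al /\ logn p (gap al) = (2 * m)%N.
  by apply: logn_gap al_m => //; lia.
rewrite -/c in ca R1; set g := c ^+ _ in ca cb.
have pg : p.-elt g := p_eltX _ pc.
have gp : g \in <[g ^+ p]>.
  rewrite -cycle_subG cb -(cycle_expg_logn p_pr pb n0 nlog) cycle_subG R1 groupM //.
    have /dvdnP[y ->] : p ^ (2 * l - m) * p %| gap al.
      by rewrite -expnSr pfactor_dvdn // Ylog; lia.
    by rewrite (mulnC y) !expgnA mem_cycle.
  have /dvdnP[y ->] : p ^ (m + l) * p %| j.
    by apply: dvdn_trans jd; rewrite -expnSr dvdn_exp2l //; lia.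
  rewrite (mulnC y) !expgnA groupX //.
  have /cycleP[i ->] : a ^+ (p ^ (m + l)) \in <[g]> by rewrite ca cycle_id.
  by rewrite -(expgnA g) mulnC (expgnA g) mem_cycle.
have g1 : g = 1.
  have : generator <[g]> (g ^+ p).
    by rewrite /generator eqEsubset !cycle_subG gp mem_cycle.
  rewrite generator_coprime; have [i oi] := p_natP pg.
  rewrite oi; case: i oi => [|i] oi; first by move=> _; apply/eqP; rewrite -order_eq1 oi.
  by rewrite expnS coprimeMl (prime_coprime _ p_pr) dvdnn.
by split=> //; apply/eqP; rewrite -cycle_eq1 -?ca -?cb g1 cycle1.
Qed.

End UpperBounds.

Section ClassFive.
Variables (gT : finGroupType) (p al be m l : nat) (a b : gT) (P : {group gT}).
Hypotheses (p_pr : prime p) (p_gt2 : 2 < p) (hab : Mrels al be a b).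
Let c := [~ a, b].
Hypotheses (pP : p.-group P) (defP : P :=: <[b]> * (<[c]> * <[a]>)).
Hypotheses (al_gt1 : 1 < al) (be_gt1 : 1 < be).
Hypotheses (al_m : logn p (al - 1) = m) (be_m : logn p (be - 1) = m).
Hypotheses (ml : m < l) (lm : 2 * l < 3 * m).
Hypotheses (a1 : a ^+ (p ^ (m + l)) = 1) (b1 : b ^+ (p ^ (m + l)) = 1).
Hypothesis (c1 : c ^+ (p ^ (2 * l - m)) = 1).

Lemma memP : [/\ a \in P, b \in P & c \in P].
Proof.
rewrite defP; split; last first.
- by rewrite -[X in X \in _]mul1g mem_mulg // -[X in X \in _]mulg1 mem_mulg ?cycle_id.
- by rewrite -[X in X \in _]mulg1 mem_mulg ?cycle_id // -[1]mulg1 mem_mulg.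
by rewrite -[X in X \in _]mul1g mem_mulg // -[X in X \in _]mul1g mem_mulg ?cycle_id.
Qed.

Lemma genP : P :=: <<[set a; b]>>.
Proof.
have [Pa Pb _] := memP; apply/eqP; rewrite eqEsubset.
rewrite gen_subG subUset !sub1set Pa Pb andbT defP.
have Ga : a \in <<[set a; b]>> by rewrite mem_gen ?inE ?eqxx.
have Gb : b \in <<[set a; b]>> by rewrite mem_gen ?inE ?eqxx ?orbT.
by rewrite !mul_subG ?cycle_subG // groupR.
Qed.

(** Modulo the n-th centre, an element that commutes with both generators is central. *)
Lemma ucn_step n x : x \in P -> [~ x, a] \in 'Z_n(P) -> [~ x, b] \in 'Z_n(P) ->
  x \in 'Z_n.+1(P).
Proof.
move=> Px Za Zb; have nZ : P \subset 'N('Z_n(P)) := ucn_norm n P.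
rewrite ucnSnR inE Px -quotient_cents2 //; last by rewrite sub1set (subsetP nZ).
have [Pa Pb _] := memP.
have E : P / 'Z_n(P) = <<[set a; b] / 'Z_n(P)>>.
  by rewrite -quotient_gen -?genP // subUset !sub1set !(subsetP nZ).
rewrite centsC E gen_subG.
apply: quotient_cents2r; rewrite gen_subG; apply/subsetP=> _ /imset2P[g y + /set1P-> ->].
by rewrite -invg_comm groupV => /set2P[] ->.
Qed.

Lemma expg_mod_cycle (x : gT) i j d : i = j %[mod d] -> x ^- j * x ^+ i \in <[x ^+ d]>.
Proof.
move=> /eqP; have [ij|/ltnW ij] := leqP j i.
  rewrite eqn_mod_dvd // => /dvdnP[k E]; rewrite -(subnK ij) E addnC expgD mulKg.
  by rewrite mulnC expgnA mem_cycle.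
rewrite eq_sym eqn_mod_dvd // => /dvdnP[k E]; rewrite -(subnK ij) E addnC expgD invMg mulgKV.
by rewrite mulnC expgnA groupV mem_cycle.
Qed.

Lemma commg_pow_geom n (x y : gT) ax : x ^ [~ x, y] = x ^+ ax ->
  [~ x ^+ n, y] = [~ x, y] ^+ n * (x ^- (n * ax ^ n) * x ^+ (ax * geom ax n)).
Proof.
move=> hx; rewrite commgEl (conjgX_geom _ hx) !mulgA; congr (_ * _).
apply: (mulgI (x ^+ n)); rewrite mulKVg mulgA (expg_comm _ _ hx) -mulgA.
by rewrite mulgV mulg1.
Qed.

Lemma commg_conj_pow n (x z : gT) ax : x ^ z = x ^+ ax ->
  [~ z ^+ n, x] = x ^- (ax ^ n) * x ^+ 1.
Proof. by move=> hx; rewrite commgEl (expg_conjg _ hx) !mulgA mulVg mul1g. Qed.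

Lemma ucn_commVl n (x y : gT) : x \in P -> [~ x^-1, y] \in 'Z_n(P) -> [~ x, y] \in 'Z_n(P).
Proof.
move=> Px; have -> : [~ x^-1, y] = ([~ x, y]^-1) ^ x^-1.
  by rewrite /commg /conjg !invMg !invgK !mulgA mulgK.
by rewrite memJ_norm ?groupV // (subsetP (ucn_norm n P)) ?groupV.
Qed.

Section OneGenerator.
Variables (x y : gT) (ax : nat).
Hypotheses (hx : x ^ [~ x, y] = x ^+ ax) (ax_gt1 : 1 < ax).
Hypotheses (pax : p ^ m %| ax - 1) (x1 : x ^+ (p ^ (m + l)) = 1).
Hypothesis c1' : [~ x, y] ^+ (p ^ (2 * l - m)) = 1.

Let axE : ax = (ax - 1).+1. Proof. lia. Qed.
Let ax_mod k : k <= m -> ax = 1 %[mod p ^ k].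
Proof.
move=> km; apply/eqP; rewrite eqn_mod_dvd ?(ltnW ax_gt1) //.
by rewrite (dvdn_trans _ pax) ?dvdn_exp2l.
Qed.

Let geom_mod k : k <= 2 * m -> ax * geom ax (p ^ k) = p ^ k %[mod p ^ (m + k)].
Proof.
move=> k2; have -> : (ax * geom ax (p ^ k) = p ^ k * (ax - 1) + p ^ k %[mod p ^ (m + k)]).
  rewrite -modnMmr {2}axE (geom_modp p_pr p_gt2 _ k2) ?modnMmr //; last by lia.
  by congr (_ %% _)%N; rewrite {1}axE; ring.
by rewrite addnC mulnC addnC expnD -modnDml (eqP (dvdn_mul pax (dvdnn _))) ?add0n.
Qed.

Let pow_mod j k : (p ^ k * ax ^ j)%N = (p ^ k)%N %[mod (p ^ (m + k))%N].
Proof.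
rewrite addnC expnD -{3}(muln1 (p ^ k)%N) -!muln_modr; congr (_ * _)%N.
exact/modn1_exp/ax_mod.
Qed.

(** The power of the commutator dies since 2m >= 2l - m, and the two powers of [x] cancel since
    their exponents agree modulo p^(3m) and m + l <= 3m. *)
Lemma commg_expg_2m : [~ x ^+ (p ^ (2 * m)), y] = 1.
Proof.
have [k ml2] : exists k, (2 * m = 2 * l - m + k)%N by exists (3 * m - 2 * l)%N; lia.
rewrite (commg_pow_geom _ hx) {1}ml2 expnD expgnA c1' expg1n mul1g.
have d : p ^ (m + l) %| p ^ (m + 2 * m) by rewrite dvdn_exp2l //; lia.
have := expg_mod_cycle x (etrans (geom_mod (leqnn _)) (esym (pow_mod (p ^ (2 * m)) (2 * m)))).
case/dvdnP: d => i ->; rewrite (mulnC i) (expgnA x (p ^ (m + l))%N) x1 expg1n cycle1.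
exact: set1P.
Qed.

Lemma commg_comm_expg_m : [~ [~ x, y] ^+ (p ^ m), x] \in <[x ^+ (p ^ (2 * m))]>.
Proof.
rewrite (commg_conj_pow _ hx); apply: expg_mod_cycle; apply/esym.
have /dvdnP[g gE] : p ^ m %| geom ax (p ^ m).
  by rewrite /dvdn (geom_modn _ (ax_mod (leqnn _))) modnn.
have := geom_mul (ax - 1) (p ^ m); rewrite -axE gE => <-.
by case/dvdnP: pax => h ->; rewrite mul2n -addnn expnD mulnACA modnMDl.
Qed.

Lemma commg_expg_m :
  [~ x ^+ (p ^ m), y] \in <[[~ x, y] ^+ (p ^ m)]> * <[x ^+ (p ^ (2 * m))]>.
Proof.
rewrite (commg_pow_geom _ hx) mem_mulg ?cycle_id //; apply: expg_mod_cycle.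
rewrite mul2n -addnn pow_mod; apply: geom_mod; lia.
Qed.

Lemma commg_comm : [~ [~ x, y], x] \in <[x ^+ (p ^ m)]>.
Proof.
have := commg_conj_pow 1 hx; rewrite expg1 => ->.
by apply: expg_mod_cycle; rewrite expn1 ax_mod.
Qed.
End OneGenerator.

Let pal : p ^ m %| al - 1. Proof. by rewrite -al_m pfactor_dvdnn. Qed.
Let pbe : p ^ m %| be - 1. Proof. by rewrite -be_m pfactor_dvdnn. Qed.
Let cV : [~ b, a] = c^-1. Proof. by rewrite -invg_comm. Qed.
Let hb : b ^ [~ b, a] = b ^+ be := hab.2.
Let c1V : [~ b, a] ^+ (p ^ (2 * l - m)) = 1.
Proof. by rewrite cV expgVn c1 invg1. Qed.

Lemma ucn1_gens : a ^+ (p ^ (2 * m)) \in 'Z_1(P) /\ b ^+ (p ^ (2 * m)) \in 'Z_1(P).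
Proof.
have [Pa Pb Pc] := memP.
have comX (x : gT) n : [~ x ^+ n, x] = 1 by apply/eqP/commgP/commute_sym/commuteX.
split; apply: ucn_step; rewrite ?groupX ?comX // ?ucn0 ?inE.
  by rewrite (commg_expg_2m hab.1 al_gt1 pal a1 c1).
by rewrite (commg_expg_2m hb be_gt1 pbe b1 c1V).
Qed.

(** Climb the upper central series: the p^(2m)-th powers of [a] and [b] lie in the first term,
    c^(p^m) in the second, a^(p^m) and b^(p^m) in the third, [c] in the fourth. *)
Lemma class_le5 : 'Z_5(P) = P.
Proof.
have [Pa Pb Pc] := memP; have [Za1 Zb1] := ucn1_gens.
have comX n (x : gT) i : [~ x ^+ i, x] \in 'Z_n(P).
  by rewrite (_ : [~ _, _] = 1) //; apply/eqP/commgP/commute_sym/commuteX.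
have sub n (x y : gT) : x \in <[y]> -> y \in 'Z_n(P) -> x \in 'Z_n(P).
  by case/cycleP=> i -> /groupX.
have Zc2 : c ^+ (p ^ m) \in 'Z_2(P).
  apply: ucn_step; first by rewrite groupX.
    exact: sub (commg_comm_expg_m hab.1 al_gt1 pal) Za1.
  apply: ucn_commVl; first by rewrite groupX.
  by rewrite -expgVn -cV; apply: sub (commg_comm_expg_m hb be_gt1 pbe) Zb1.
have up n x : x \in 'Z_n(P) -> x \in 'Z_n.+1(P) by apply/subsetP/ucn_subS.
have Za3 : a ^+ (p ^ m) \in 'Z_3(P).
  apply: ucn_step; rewrite ?groupX ?comX //.
  have := commg_expg_m hab.1 al_gt1 pal => /mulsgP[y z ycyc zcyc ->].
  by apply: groupM; [exact: sub ycyc _ | apply: sub zcyc _; exact: up].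
have Zb3 : b ^+ (p ^ m) \in 'Z_3(P).
  apply: ucn_step; rewrite ?groupX ?comX //.
  have := commg_expg_m hb be_gt1 pbe => /mulsgP[y z ycyc zcyc ->].
  apply: groupM; last by apply: sub zcyc _; exact: up.
  by apply: sub ycyc _; rewrite cV expgVn groupV.
have Zc4 : c \in 'Z_4(P).
  apply: ucn_step => //; first exact: sub (commg_comm hab.1 al_gt1 pal) Za3.
  by apply: ucn_commVl => //; rewrite -cV; apply: sub (commg_comm hb be_gt1 pbe) Zb3.
apply/eqP; rewrite eqEsubset ucn_sub /= {1}genP gen_subG subUset !sub1set.
apply/andP; split; apply: ucn_step; [exact: Pa | | exact: Zc4 | exact: Pb | | ].
- by rewrite commgg group1.
- by rewrite cV groupV.
by rewrite commgg group1.
Qed.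

(** With u = al - 1, a^u is up to inversion [c, a], so [[a^u, b], a] lies in the fifth term of the
    lower central series. It is a conjugate of a^(1 - al^u), where al^u - 1 has valuation only 2m <
    m + l. *)
Lemma class_ge5 : #[a] = (p ^ (m + l))%N -> 5 <= nil_class P.
Proof.
move=> oa; have [Pa Pb Pc] := memP; have nilP := pgroup_nil pP.
rewrite leqNgt ltnS; apply/negP => /(lcn_nil_classP 4 nilP) L5.
have step n x y : x \in 'L_n.+1(P) -> y \in P -> [~ x, y] \in 'L_n.+2(P).
  by move=> Lx Py; rewrite lcnSn mem_commg.
have Lc : c \in 'L_2(P) by apply: step; rewrite ?lcn1.
have La : a ^+ (al - 1) \in 'L_3(P).
  have := step _ _ _ Lc Pa; have := commg_conj_pow 1 hab.1; rewrite !expg1 expn1 => ->.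
  have -> : a ^+ (al - 1) = a^-1 * a ^+ al.
    by apply: (mulgI a); rewrite mulKVg -expgS subn1 prednK // ltnW.
  by rewrite -groupV invMg invgK.
have := step _ _ _ (step _ _ _ La Pb) Pa.
rewrite L5 (commg_pow_geom _ hab.1) -/c => /set1gP.
set t := a ^- _ * _; have ta : commute t a.
  by apply/commute_sym/commuteM; [apply/commuteV/commuteX | apply/commuteX].
rewrite commMgJ (_ : [~ t, a] = 1) ?mulg1; last exact/eqP/commgP.
move/eqP; rewrite conjg_eq1 (commg_conj_pow _ hab.1) -eq_mulVg1 eq_expg_mod_order.
rewrite oa eqn_mod_dvd ?expn_gt0 ?(ltnW al_gt1) //.
have alE : al = (al - 1).+1 by rewrite subn1 prednK // ltnW.
have u0 : 0 < al - 1 by rewrite subn_gt0.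
have m0 : 0 < m by move: ml lm; clear; lia.
have [g0 glog] : 0 < geom al (al - 1) /\ logn p (geom al (al - 1)) = m.
  apply: (logn_eq_mod p_pr u0 al_m (_ : m < m + m)).
    by rewrite -[X in X < _]addn0 ltn_add2l.
  by rewrite {1}alE; apply: geom_modp => //; apply: leq_pmull.
have := geom_mul (al - 1) (al - 1); rewrite -alE => <-; rewrite addnK.
by rewrite pfactor_dvdn ?muln_gt0 ?u0 // lognM // al_m glog leq_add2l leqNgt ml.
Qed.

(** By the first relation c^(p^l) is a product of central powers of [b] and [a], so in <b><c><a> the
    exponent of [c] can be reduced below p^l. *)
Lemma card_le dl : al = (be + dl)%N -> logn p dl = l -> #|P| <= p ^ (2 * m + 3 * l).
Proof.
move=> al_be dl_l; have [Pa Pb Pc] := memP.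
have [pa pb pc] : [/\ p.-elt a, p.-elt b & p.-elt c] by split; apply: mem_p_elt pP _.
have [Z [Z0 Zlog] R0] :=
  first_relator p_pr p_gt2 hab pa pb pc al_gt1 be_gt1 al_m be_m ml lm al_be dl_l.
have dl0 : 0 < dl by case: (dl) dl_l ml => // <-; rewrite logn0.
have pgt0 k : 0 < p ^ k by rewrite expn_gt0 prime_gt0.
have Zb : b ^+ Z \in 'Z(P).
  rewrite -ucn1; have /dvdnP[i ->] : p ^ (2 * m) %| Z by rewrite -Zlog pfactor_dvdnn.
  by rewrite mulnC expgnA groupX //; case: ucn1_gens.
have Za : a ^+ gap al \in 'Z(P).
  have m1 : 1 < m by move: ml lm; clear; lia.
  have [_ Ylog] := logn_gap p_pr p_gt2 m1 al_m.
  rewrite -ucn1; have /dvdnP[i ->] : p ^ (2 * m) %| gap al by rewrite -Ylog pfactor_dvdnn.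
  by rewrite mulnC expgnA groupX //; case: ucn1_gens.
have cpl : exists i, c ^+ (p ^ l) = b ^+ (Z * i) * a ^+ (gap al * i).
  have : c ^+ (p ^ l) \in <[c ^+ dl]> by rewrite (cycle_expg_logn p_pr pc dl0 dl_l) cycle_id.
  case/cycleP=> i ->; exists i; rewrite -R0 expgMn ?expgnA //.
  by case/setIP: Zb => _ /centP; apply; rewrite groupX.
have [i ci] := cpl.
pose f (t : gT * 'I_(p ^ l) * gT) := t.1.1 * c ^+ t.1.2 * t.2.
have sPf : P \subset f @: setX (setX <[b]> [set: 'I_(p ^ l)]) <[a]>.
  rewrite defP; apply/subsetP=> _ /mulsgP[x _ bx /mulsgP[_ z /cycleP[j ->] az ->] ->].
  apply/imsetP; exists (x * b ^+ (Z * i * (j %/ p ^ l)), Ordinal (ltn_pmod j (pgt0 l)),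
                        a ^+ (gap al * i * (j %/ p ^ l)) * z).
    by rewrite !inE /= !groupM // mem_cycle.
  rewrite /f /= {1}(divn_eq j (p ^ l)) expgD (mulnC _ (p ^ l)%N) expgnA ci.
  have cen (y g : gT) n : y \in 'Z(P) -> g \in P -> commute (y ^+ n) g.
    by move=> Zy Pg; apply/commute_sym/commuteX/commute_sym; case/setIP: Zy => _ /centP; apply.
  rewrite expgMn; last by rewrite expgnA; apply: cen => //; rewrite groupX.
  rewrite -!expgnA -!mulnA -!mulgA; do 2![congr (_ * _)].
  rewrite (mulgA (a ^+ _)) (mulgA (c ^+ _)); congr (_ * z).
  by rewrite expgnA; apply: cen => //; rewrite groupX.
apply: leq_trans (subset_leq_card sPf) (leq_trans (leq_imset_card _ _) _).
rewrite !cardsX cardsT card_ord -!orderE.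
have le (x : gT) : x ^+ (p ^ (m + l)) = 1 -> #[x] <= p ^ (m + l).
  by move/eqP; rewrite -order_dvdn => /dvdn_leq->.
have := leq_mul (leq_mul (le b b1) (leqnn (p ^ l)%N)) (le a a1).
move=> h; apply: leq_trans h _.
rewrite -(expnD p) -(expnD p) leq_exp2l ?prime_gt1 //; clear; lia.
Qed.

End ClassFive.
End SylowUpperBounds.

(** * A permutation model *)

Section ModelAlgebra.
Import GRing.Theory.
Local Open Scope ring_scope.

Section Model.
(* With u = alpha - 1: s = u / 2, g = u^2 / 12, d = alpha - beta, ka = g / d and v = beta - 1. *)
Variables (R : comNzRingType) (s g d ka h : R) (v : nat).
Hypotheses (s2 : s ^+ 2 = 3 * g) (sg : s * g = 0) (g2 : g ^+ 2 = 0).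
Hypotheses (ds : d * s = 0) (dg : d * g = 0) (dka : d * ka = g) (gka : 6 * (g * ka) = 0).
Hypotheses (h2 : 2 * h = 1) (vE : v%:R = 2 * s - d).

Implicit Types x y : R * R.

Definition model_A x : R * R := (x.1, x.2 + 1).
Definition model_w (a : R) := a + s * (a * (a + 1)) + 2 * g * (a ^+ 3 - a).
Definition model_B x : R * R := (x.1 + x.2, model_w x.2).
Definition model_C x : R * R := (x.1 + 1, (1 + 2 * s) * x.2).
(** Here 6g is u^2 / 2, so this is congruence modulo the multiples of (alpha - beta, - u^2 / 2). *)
Definition model_eq x y := exists k, x.1 - y.1 = d * k /\ x.2 - y.2 = - (6 * g * k).

Lemma model_eq_A x y : model_eq x y -> model_eq (model_A x) (model_A y).
Proof. by case=> k [E1 E2]; exists k; split=> //=; rewrite -E2; ring. Qed.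

Lemma model_eq_C x y : model_eq x y -> model_eq (model_C x) (model_C y).
Proof.
case=> k [E1 E2]; exists k; split=> /=; first by rewrite -E1; ring.
by rewrite -mulrBr E2; ring: sg.
Qed.

Lemma model_eq_B x y : model_eq x y -> model_eq (model_B x) (model_B y).
Proof.
case: x y => [c a] [c' a'] [k [/= E1 E2]].
have -> : c = c' + d * k by rewrite -E1; ring.
have -> : a = a' - 6 * g * k by rewrite -[_ * k]opprK -E2; ring.
exists (k - 6 * ka * k); split; rewrite /= ?/model_w.
  by ring: dka.
have -> : 6 * g * (k - 6 * ka * k) = 6 * g * k - 6 * (6 * (g * ka)) * k by ring.
by rewrite gka; ring: sg g2.
Qed.

(** The generators act on the right, so this reads A B = B A C; it makes [model_C] the action of the
    commutator. *)
Lemma model_AB x : model_B (model_A x) = model_C (model_A (model_B x)).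
Proof.
case: x => c a; rewrite /model_A /model_B /model_C /model_w /=; congr (_, _); first by ring.
by ring: s2 sg.
Qed.

Lemma iter_model_A n x : iter n model_A x = (x.1, x.2 + n%:R).
Proof.
elim: n => [|n IHn]; first by rewrite addr0; case: x.
by rewrite iterS IHn /model_A /= -natr1 addrA.
Qed.

Lemma iter_model_C n : iter n model_C (0, 0) = (n%:R, 0).
Proof. by elim: n => // n IHn; rewrite iterS IHn /model_C /= mulr0 natr1. Qed.

(** The coefficient [z] need not be known: [d * ka = g] and [6 * (g * ka) = 0] let [model_eq] absorb
    multiples of [g] in the first coordinate. *)
Lemma iter_model_B n c a : exists z, iter n model_B (c, a) =
  (c + n%:R * a + 'C(n, 2)%:R * s * (a * (a + 1)) + g * z,
   a + n%:R * s * (a * (a + 1)) + n%:R * g * (2 * (a ^+ 3 - a))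
     + 'C(n, 2)%:R * g * (3 * (a * (a + 1) * (2 * a + 1)))).
Proof.
elim: n => [|n [z IHn]]; first by exists 0; rewrite bin0n /= !(mulr0n, mulr0, mul0r, addr0).
rewrite iterS IHn /model_B /=.
set N := n%:R; set b2 := 'C(n, 2)%:R.
have -> : n.+1%:R = N + 1 :> R by rewrite natr1.
have -> : 'C(n.+1, 2)%:R = b2 + N :> R by rewrite binS bin1 natrD.
exists (z + 2 * N * (a ^+ 3 - a) + 3 * b2 * (a * (a + 1) * (2 * a + 1))).
congr (_, _); first by ring.
by rewrite /model_w; ring: s2 sg g2.
Qed.

Lemma s_cubed : s ^+ 3 = 0.
Proof. by rewrite exprS s2 mulrCA sg mulr0. Qed.

Lemma bin2_v : 'C(v, 2)%:R * s = - (3 * g) /\ 'C(v, 2)%:R * g = 0.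
Proof.
have E : 2 * 'C(v, 2)%:R = v%:R ^+ 2 - v%:R :> R.
  by have := congr1 (fun n => n%:R : R) (bin2_eq v); rewrite /= natrD natrM natrX => <-; ring.
have half (z : R) : h * (2 * 'C(v, 2)%:R * z) = 'C(v, 2)%:R * z.
  by transitivity (2 * h * ('C(v, 2)%:R * z)); [ring | rewrite h2 mul1r].
split; rewrite -half E vE.
  by transitivity (- (3 * g) * (2 * h)); [ring: s_cubed ds sg dg s2 | rewrite h2 mulr1].
by ring: sg dg.
Qed.

Lemma model_CB x : model_eq (model_B (model_C x)) (model_C (iter v.+1 model_B x)).
Proof.
case: x => c a; have [z E] := iter_model_B v c a; have [b1 b2] := bin2_v.
have us : v%:R * s = 6 * g by rewrite vE; ring: ds s2.
have ug : v%:R * g = 0 by rewrite vE; ring: dg sg.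
rewrite iterS E us ug b1 b2 vE !mul0r !addr0.
set f := - (3 * (a * (a + 1))) + z + 6 * (a * (a + 1)).
(* The first coordinates differ by d a - g f, and g = d ka; in the second coordinate the [ka] part
   is killed by [gka]. *)
exists (a - ka * f); rewrite /f; split; rewrite /=; first by ring: dka.
have -> : 6 * g * (a - ka * f) = 6 * g * a - 6 * (g * ka) * f by ring.
by rewrite gka /model_w; ring: s_cubed sg g2 s2.
Qed.
End Model.
End ModelAlgebra.

(** * Constants of the model over a ring in which p^(m+l) = 0 *)

Section ModelConstants.
Import GRing.Theory.
Local Open Scope ring_scope.

Section Constants.
Variables (R : comUnitRingType) (p m l u0 d0 : nat).
Hypotheses (p_pr : prime p) (p_gt2 : (2 < p)%N).
Hypotheses (ml : (m < l)%N) (lm : (2 * l < 3 * m)%N).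
Hypothesis unitR : forall n, coprime p n -> (n%:R : R) \is a GRing.unit.
Hypothesis pN0 : (p ^ (m + l))%:R = 0 :> R.
Hypotheses (pu0 : coprime p u0) (pd0 : coprime p d0).

(** This replaces division by 3, which is impossible when p = 3: there p / 6 is simply 1 / 2. *)
Lemma six_divides_p : exists y : R, 6 * y = p%:R.
Proof.
have u2 : (2%:R : R) \is a GRing.unit by apply: unitR; rewrite prime_coprime // gtnNdvd.
have [->|p3] := eqVneq p 3%N.
  exists (2%:R^-1); rewrite (_ : 6 = 3 * 2%:R); last by ring.
  by rewrite mulrK.
have u3 : (3%:R : R) \is a GRing.unit by apply: unitR; rewrite prime_coprime // dvdn_prime2.
exists (p%:R * 2%:R^-1 * 3%:R^-1).
rewrite (_ : 6 * _ = p%:R * (2%:R^-1 * 2%:R) * (3%:R^-1 * 3%:R)); last by ring.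
by rewrite !mulVr // !mulr1.
Qed.

Lemma model_constants : exists s g ka h w : R,
  [/\ [/\ s ^+ 2 = 3 * g, s * g = 0 & g ^+ 2 = 0],
      [/\ (p ^ l * d0)%:R * s = 0, (p ^ l * d0)%:R * g = 0,
          (p ^ l * d0)%:R * ka = g & 6 * (g * ka) = 0],
      2 * h = 1, (p ^ m * u0)%:R = 2 * s &
      w \is a GRing.unit /\ 6 * ka = (p ^ (2 * m - l))%:R * w].
Proof.
have [y yE] := six_divides_p.
have u2 : (2%:R : R) \is a GRing.unit by apply: unitR; rewrite prime_coprime // gtnNdvd.
have uu := unitR pu0; have ud := unitR pd0.
pose h : R := 2%:R^-1; have h2 : 2 * h = 1 by rewrite /h divrr.
pose P k : R := (p ^ k)%:R.
have PD i j : P i * P j = P (i + j)%N by rewrite /P expnD natrM.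
have P0 k : (m + l <= k)%N -> P k = 0.
  by move=> /subnK <-; rewrite -PD /P pN0 mulr0.
have PS k : p%:R * P k = P k.+1 by rewrite /P -natrM expnS.
set u := u0%:R in uu; set d := d0%:R in ud.
have d1 : d * d^-1 = 1 by rewrite divrr.
pose x := u ^+ 2 * (h * y); pose di := d^-1.
(* One factor [p] of p^(2m) is spent on [y] = p / 6, so the second witness is p^(2m) u^2 / 12; the
   third is its quotient by p^l d. *)
exists (h * (P m * u)), (P (2 * m - 1)%N * x), (P (2 * m - 1 - l)%N * (x * di)), h,
  (u ^+ 2 * h * di).
have p6 : 6 * (h * y) * P (2 * m - 1)%N = h * P (2 * m)%N.
  rewrite -[X in _ = _ * P X](_ : (2 * m - 1).+1 = 2 * m)%N; last by lia.
  by rewrite -PS -yE; ring.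
rewrite !natrM -/u -/d -!/(P _); split=> //.
- split.
  + transitivity (h * u ^+ 2 * (h * P (2 * m)%N)).
      by rewrite mul2n -addnn -PD; ring.
    rewrite -p6; transitivity ((2 * h) * (3 * (P (2 * m - 1)%N * x))).
      by rewrite /x; ring.
    by rewrite h2 mul1r.
  + transitivity (P m * P (2 * m - 1)%N * (h * u * x)); first by ring.
    by rewrite PD P0 ?mul0r //; lia.
  + transitivity (P (2 * m - 1)%N * P (2 * m - 1)%N * x ^+ 2); first by ring.
    by rewrite PD P0 ?mul0r //; lia.
- split.
  + transitivity (P l * P m * (d * h * u)); first by ring.
    by rewrite PD P0 ?mul0r //; lia.
  + transitivity (P l * P (2 * m - 1)%N * (d * x)); first by ring.
    by rewrite PD P0 ?mul0r //; lia.
  + transitivity (P l * P (2 * m - 1 - l)%N * x * (d * d^-1)); first by rewrite /di; ring.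
    by rewrite d1 mulr1 PD; congr (P _ * _); lia.
  + transitivity ((6 * (h * y) * P (2 * m - 1)%N) * P (2 * m - 1 - l)%N * (u ^+ 2 * x * di)).
      by rewrite {1}/x; ring.
    rewrite p6; transitivity (P (2 * m)%N * P (2 * m - 1 - l)%N * (h * (u ^+ 2 * x * di))).
      by ring.
    by rewrite PD P0 ?mul0r //; lia.
- by transitivity (P m * u * (2 * h)); [rewrite h2 mulr1 | ring].
split; first by rewrite !unitrM ?unitrX // /h /di !unitrV u2 ud ?uu.
rewrite -[X in _ = P X * _](_ : (2 * m - 1 - l).+1 = 2 * m - l)%N; last by lia.
by rewrite -PS -yE /x; ring.
Qed.
End Constants.
End ModelConstants.

(** * Finite permutation groups satisfying the relations *)

Section PermutationModel.
Import GRing.Theory.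

Section Descent.
Variables (T : finType) (V : Type) (pr : V -> T) (sec : T -> V).
Hypothesis prK : cancel sec pr.

Definition descend (f : V -> V) t := pr (f (sec t)).

Lemma descendE f : (forall x y, pr x = pr y -> pr (f x) = pr (f y)) ->
  forall x, descend f (pr x) = pr (f x).
Proof. by move=> fpr x; apply: fpr; rewrite prK. Qed.

Lemma iter_descend f : (forall x y, pr x = pr y -> pr (f x) = pr (f y)) ->
  forall n x, iter n (descend f) (pr x) = pr (iter n f x).
Proof. by move=> fpr n x; elim: n => // n IHn; rewrite !iterS IHn descendE. Qed.

Lemma descend_inj f n : (forall x y, pr x = pr y -> pr (f x) = pr (f y)) ->
  (forall x, pr (iter n.+1 f x) = pr x) -> injective (descend f).
Proof.
move=> fpr fn; have K t : iter n.+1 (descend f) t = t.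
  by rewrite -[t]prK iter_descend.
by move=> t t' E; rewrite -[t]K -[t']K !iterSr E.
Qed.
End Descent.

Section FiniteModel.
Variables (p m l al be dl : nat).
Hypotheses (p_pr : prime p) (p_gt2 : 2 < p) (be_gt0 : 0 < be).
Hypotheses (al_m : logn p (al - 1) = m) (al_be : al = be + dl) (dl_l : logn p dl = l).
Hypotheses (ml : m < l) (lm : 2 * l < 3 * m).

Let q := p ^ (m + l).
Local Notation R := 'Z_q.
Let q_gt1 : 1 < q. Proof. by rewrite -(exp1n (m + l)) ltn_exp2r ?prime_gt1 //; lia. Qed.
Let pl_gt0 : 0 < p ^ l. Proof. by rewrite expn_gt0 prime_gt0. Qed.

Lemma Zp_nat_eq x y : (x%:R == y%:R :> R)%R = (x == y %[mod q]).
Proof. by rewrite -val_eqE /= !val_Zp_nat. Qed.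

Theorem finite_model : exists (T : finType) (x y : {perm T}) (t0 : T),
  [/\ Mrels al be x y, #|T| = p ^ (m + 2 * l),
      #[x]%g = p ^ (m + l) /\ #[y]%g %| p ^ (m + l),
      p ^ (2 * l - m) %| #[[~ x, y]]%g &
      y t0 = t0 /\ forall t, exists z : {perm T}, z \in <<[set x; y]>>%g /\ z t0 = t].
Proof.
have al1 : 0 < al - 1.
  by rewrite lt0n; apply/eqP => al0; move: al_m; rewrite al0 logn0; lia.
have dl0 : 0 < dl by case: (dl) dl_l ml => // <-; rewrite logn0.
have [u0 pu0 uE] := pfactor_coprime p_pr al1.
have [d0 pd0 dE] := pfactor_coprime p_pr dl0.
rewrite al_m mulnC in uE; rewrite dl_l mulnC in dE.
have unitR n : coprime p n -> (n%:R : R)%R \is a GRing.unit.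
  by move=> co; rewrite unitZpE // coprimeXl.
have pN0 : ((p ^ (m + l))%N%:R = 0 :> R)%R by apply/eqP; rewrite (Zp_nat_eq _ 0) modnn mod0n.
have [s [g [ka [h [w [[s2 sg g2] [ds dg dka gka] h2 us [uw wE]]]]]]] :=
  model_constants p_pr p_gt2 ml lm unitR pN0 pu0 pd0.
rewrite -dE in ds dg dka gka; rewrite -uE in us.
have vE : ((be - 1)%:R = 2 * s - dl%:R :> R)%R.
  by rewrite -us (_ : al - 1 = be - 1 + dl); [rewrite natrD addrK | lia].
have alR : (al%:R = 1 + 2 * s :> R)%R.
  rewrite -us -[1%R]/(1%:R)%R -natrD; congr (_%:R)%R; lia.
pose T : finType := ('I_(p ^ l) * R)%type.
(* Normal forms for [model_eq]: the second component is invariant since 6 ka d = 6 g, and the first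
   coordinate counts only modulo p^l. *)
pose pr (x : R * R) : T := (Ordinal (ltn_pmod (x.1 : nat) pl_gt0), x.2 + 6 * ka * x.1)%R.
pose sec (t : T) : R * R := ((t.1 : nat)%:R, t.2 - 6 * ka * (t.1 : nat)%:R)%R.
have plq : p ^ l %| q by rewrite dvdn_exp2l ?leq_addl.
have secK : cancel sec pr.
  case=> i b; rewrite /pr /sec /= subrK; congr (_, _); apply: val_inj => /=.
  by rewrite val_Zp_nat // modn_dvdm // modn_small.
have prP x y : pr x = pr y <-> model_eq g (dl%:R)%R x y.
  case: x y => [c a] [c' a']; split.
    move=> E; have Ec : c = c' %[mod p ^ l] := congr1 (fun t : T => (t.1 : nat)) E.
    have Ea : (a + 6 * ka * c = a' + 6 * ka * c')%R := congr1 snd E.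
    exists (d0%:R^-1 * ((c %/ p ^ l)%:R - (c' %/ p ^ l)%:R))%R => /=.
    set k := (d0%:R^-1 * _)%R.
    have E1 : (c - c' = dl%:R * k)%R.
      rewrite -(natr_Zp c) -(natr_Zp c') {1}(divn_eq c (p ^ l)) {1}(divn_eq c' (p ^ l)).
      rewrite Ec !natrD !natrM dE natrM /k -(mulrA _ d0%:R)%R.
      by rewrite (mulVKr (unitR _ pd0)); ring.
    split=> //; transitivity (- (6 * ka * (c - c')))%R; last first.
      by rewrite E1; ring: dka.
    transitivity ((a + 6 * ka * c) - a' - 6 * ka * c)%R; first by ring.
    by rewrite Ea; ring.
  case=> k /= [E1 E2]; rewrite /pr /=; congr (_, _); last first.
    apply/eqP; rewrite -subr_eq0; apply/eqP.
    transitivity ((a - a') + 6 * ka * (c - c'))%R; first by ring.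
    by rewrite E1 E2; ring: dka.
  apply: val_inj => /=; have : (c == (c' + dl * k)%N%:R)%R.
    by rewrite natrD natrM !natr_Zp -E1 addrC subrK.
  rewrite -{1}(natr_Zp c) Zp_nat_eq => /eqP E; rewrite -(modn_dvdm _ plq) E modn_dvdm //.
  by rewrite dE -mulnA -modnDmr modnMr addn0.
pose fB := model_B s g; pose fC := model_C s.
have cA x y : pr x = pr y -> pr (model_A x) = pr (model_A y).
  by move=> /prP E; apply/prP/model_eq_A.
have cB x y : pr x = pr y -> pr (fB x) = pr (fB y).
  by move=> /prP E; apply/prP/(model_eq_B sg g2 dka gka).
have cC x y : pr x = pr y -> pr (fC x) = pr (fC y).
  by move=> /prP E; apply/prP/(model_eq_C sg).
have qE : q.-1.+1 = q by rewrite prednK // (ltn_trans _ q_gt1).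
have q0 : (q%:R = 0 :> R)%R by exact: pN0.
have iA x : pr (iter q.-1.+1 (@model_A R) x) = pr x.
  by rewrite iter_model_A qE q0 addr0; case: x.
have iB x : pr (iter q.-1.+1 fB x) = pr x.
  rewrite qE; case: x => c a; have [z ->] := iter_model_B s2 sg g2 q c a.
  have b0 : ('C(q, 2)%:R = 0 :> R)%R.
    by apply/eqP; rewrite (Zp_nat_eq _ 0) mod0n; apply: pexp_dvd_bin2.
  rewrite b0 q0 !mul0r !addr0; apply/prP; exists (ka * z)%R => /=.
  split; first by rewrite mulrA dka; ring.
  by transitivity (- ((6 * (g * ka)) * z))%R; [rewrite gka mul0r oppr0; ring | ring].
pose pA := perm (descend_inj secK cA iA); pose pB := perm (descend_inj secK cB iB).
have AE x : pA (pr x) = pr (model_A x) by rewrite permE descendE.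
have BE x : pB (pr x) = pr (fB x) by rewrite permE descendE.
have AnE n x : (pA ^+ n)%g (pr x) = pr (iter n (@model_A R) x).
  by rewrite permX; elim: n => // n IHn; rewrite !iterS IHn AE.
have BnE n x : (pB ^+ n)%g (pr x) = pr (iter n fB x).
  by rewrite permX; elim: n => // n IHn; rewrite !iterS IHn BE.
have [c defc] : exists c, c = [~ pA, pB]%g by exists [~ pA, pB]%g.
have CE x : c (pr x) = pr (fC x).
  (* Every point has the form y B A, so the action of the commutator can be read off from A B = B A
     C. *)
  have [y xE] : exists y, pr x = pr (model_A (fB y)).
    exists (sec (pB^-1 (pA^-1 (pr x))))%g.
    by rewrite -AE -BE secK permKV permKV.
  have BA : fB (model_A y) = fC (model_A (fB y)) := model_AB s2 sg y.
  rewrite xE (cC _ _ xE) -BA -BE -AE -AE -BE -!permM; congr (fun_of_perm _ _).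
  by rewrite mulgA defc -commgC.
have CnE n x : (c ^+ n)%g (pr x) = pr (iter n fC x).
  by rewrite permX; elim: n => // n IHn; rewrite !iterS IHn CE.
have eqpr (f f' : {perm T}) : (forall x, f (pr x) = f' (pr x)) -> f = f'.
  by move=> E; apply/permP=> t; rewrite -[t]secK E.
pose t0 := pr (0, 0)%R.
have relA : (pA ^ c = pA ^+ al)%g.
  apply: (mulgI c); rewrite -conjgC; apply: eqpr => x.
  rewrite !permM AE CE CE AnE iter_model_A; congr pr.
  by rewrite /model_A /fC /model_C /= alR; congr (_, _); ring.
have relB : (pB ^ [~ pB, pA] = pB ^+ be)%g.
  rewrite -invg_comm -defc; apply: (canLR (conjgK _)); rewrite conjgE.
  apply: (mulgI c); rewrite mulKVg; apply: eqpr => x.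
  rewrite !permM CE BE BnE CE; have := model_CB s2 sg g2 ds dg dka gka h2 vE x.
  by rewrite subn1 prednK // => /prP.
exists T, pA, pB, t0; split.
- by split; rewrite -?defc.
- rewrite card_prod card_ord card_ord Zp_cast // /q -expnD; congr (_ ^ _)%N; lia.
- split; last first.
    by rewrite order_dvdn; apply/eqP/eqpr => x; rewrite BnE perm1 -[RHS]iB qE.
  apply/eqP; rewrite eqn_dvd order_dvdn; apply/andP; split.
    by apply/eqP/eqpr => x; rewrite AnE perm1 iter_model_A q0 addr0 -surjective_pairing.
  have := AnE #[pA]%g (0, 0)%R; rewrite expg_order perm1 iter_model_A => /(congr1 snd) /=.
  rewrite mulr0 !addr0 !add0r => /eqP; rewrite eq_sym.
  by rewrite (Zp_nat_eq _ 0) mod0n.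
(* c^n sends [t0] to the class of (n, 0), whose normal form has second component 6 ka n = p^(2m-l) w
   n; for n = [#[c]] this must vanish modulo p^(m+l). *)
- rewrite -defc; have := CnE #[c]%g (0, 0)%R.
  rewrite expg_order perm1 iter_model_C => /(congr1 snd) /=.
  rewrite mulr0 !add0r wE mulrAC -natrM => /esym/(canRL (mulrK uw)); rewrite mul0r => /eqP.
  rewrite (Zp_nat_eq _ 0) mod0n -/(dvdn _ _) /q.
  have -> : m + l = (2 * m - l) + (2 * l - m) by lia.
  by rewrite expnD dvdn_pmul2l // expn_gt0 prime_gt0.
split; first by rewrite BE /t0 /fB /model_B /model_w /=; congr (pr (_, _)); ring.
(* [c] moves the base point along the first coordinate and [pA] then adjusts the second to that of
   [sec]. *)
case=> i b; exists (c ^+ i * pA ^+ (b - 6 * ka * i%:R)%R)%g; split.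
  by rewrite defc groupM ?groupX ?groupR // mem_gen // !inE eqxx ?orbT.
rewrite permM CnE iter_model_C AnE iter_model_A natr_Zp -[RHS]secK /=.
by rewrite add0r.
Qed.
End FiniteModel.
End PermutationModel.

(** * The Sylow subgroup *)

Local Open Scope group_scope.
Import GRing.Theory.

Lemma zexpg_congr (gT : finGroupType) (x : gT) (z : int) n :
  (#[x] %| `|(n%:Z - z)%R|)%N -> zexpg x z = x ^+ n.
Proof.
case: z => k /=.
  move=> E; apply/eqP; rewrite eq_expg_mod_order; have [kn|/ltnW kn] := leqP k n.
    by rewrite eq_sym eqn_mod_dvd // -distnEl.
  by rewrite eqn_mod_dvd // -distnEr.
move=> d; have : (#[x] %| n + k.+1)%N.
  by rewrite (_ : n + k.+1 = `|(n%:Z - Negz k)%R|)%N //; lia.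
rewrite order_dvdn expgD => E; by apply/eqP; rewrite eq_invg_mul -(eqP E) -!expgD addnC.
Qed.

Lemma logn_congr p e (z w : int) : prime p -> z != 0%R -> logn p `|z| = e ->
  (p ^ e.+1 %| `|(w - z)%R|)%N -> (0 < `|w|)%N /\ logn p `|w| = e.
Proof.
move=> p_pr z0 ze d; apply: (@logn_eq_dvd p p_pr `|w| `|z|); rewrite ?absz_gt0 //.
move=> k ke; have dk : (p ^ k %| `|(w - z)%R|)%N by apply: dvdn_trans d; rewrite dvdn_exp2l.
have E (x : int) : (p ^ k %| `|x|)%N = ((p ^ k)%N%:Z %| x)%Z by rewrite dvdzE absz_nat.
by rewrite !E in dk *; rewrite -(subrK z w) rpredDl.
Qed.

Section UniversalImage.
Variables (gT : finGroupType) (G : {group gT}) (T : finType) (f : {morphism G >-> {perm T}}).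
Variable t0 : T.
Hypothesis transf : forall t, exists z : {perm T}, z \in f @* G /\ z t0 = t.

(** The preimage in [G] of the point stabiliser has index [#|T|] and contains [x] itself, so the
    full order of [x] counts, not just that of its image. *)
Lemma card_transitive_preim x : x \in G -> f x t0 = t0 -> (#|T| * #[x] %| #|G|)%N.
Proof.
move=> Gx fx; have orb : orbit 'P (f @* G) t0 = [set: T].
  apply/setP=> t; rewrite inE; have [z [Hz zt]] := transf t.
  by apply/orbitP; exists z => //=; rewrite apermE.
have := card_orbit_stab 'P (f @* G)%G t0; rewrite orb cardsT => E.
have kerG : 'ker f \subset G := subsetIl _ _.
have := card_morphpre (f := f) (subxx (f @* G)); rewrite (morphimGK kerG) // => ->.
rewrite -E mulnCA dvdn_pmul2l; last by apply/card_gt0P; exists t0.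
have S_sub : 'C_(f @* G)[t0 | 'P] \subset f @* G := subsetIl _ _.
rewrite -(card_morphpre S_sub); apply: order_dvdG.
by apply/mem_morphpre => //; apply/setIP; split; [apply: mem_morphim | apply/astab1P].
Qed.
End UniversalImage.

Lemma Grels_Mrels (hT : finGroupType) (alpha beta : int) al be (x y : hT) :
  (#[x] %| `|(al%:Z - alpha)%R|)%N -> (#[y] %| `|(be%:Z - beta)%R|)%N ->
  Grels alpha beta x y <-> Mrels al be x y.
Proof. by move=> /zexpg_congr dx /zexpg_congr dy; rewrite /Grels dx dy. Qed.

Local Open Scope nat_scope.
(** The window for [n] is prescribed so that representatives of different integers can be put in a
    chosen order. *)
Lemma nat_representative (z : int) (M k : nat) : (0 < M)%N -> exists n : nat,
  [/\ (k * M <= n)%N, (n < k.+1 * M)%N & (M %| `|(n%:Z - z)%R|)%N].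
Proof.
move=> M0; exists (`|(z %% M)%Z| + k * M)%N.
have M0z : (M%:Z != 0)%R by lia.
have z0 := modz_ge0 z M0z; have zM := ltz_pmod z (_ : (0 < M%:Z)%R).
have zE := divz_eq z M; set r := (z %% M)%Z in z0 zM zE *; set w := (z %/ M)%Z in zE.
have rM := zM ltac:(lia).
split; [lia | lia |].
have -> : ((`|r| + k * M)%N%:Z - z = (k%:Z - w) * M%:Z)%R.
  by rewrite {1}zE PoszD PoszM gez0_abs //; ring.
by rewrite abszM dvdn_mull.
Qed.
Lemma part_eq_exp p n k : prime p -> (0 < n)%N -> (n`_p %| p ^ k)%N -> (p ^ k %| n)%N ->
  n`_p = (p ^ k)%N.
Proof.
move=> p_pr n0 d1 d2; apply/eqP; rewrite eqn_dvd d1 /= p_part dvdn_exp2l //.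
by rewrite -pfactor_dvdn.
Qed.

Local Open Scope group_scope.

Theorem theorem7p2 (p : nat) (alpha beta : int) (m l : nat)
    (gT : finGroupType) (G : {group gT}) (A B : gT) :
  prime p ->
  alpha != 1%R -> beta != 1%R ->
  (3 < p \/ (p = 3 /\ (alpha %% 9)%Z != 7%R /\ (beta %% 9)%Z != 7%R)) ->
  logn p `|(alpha - 1)%R| = m -> logn p `|(beta - 1)%R| = m -> 0 < m ->
  logn p `|(alpha - beta)%R| = l ->
  m < l < 2 * m -> 2 * l < 3 * m ->
  is_Galphabeta G A B alpha beta ->
  forall P : {group gT}, P \in 'Syl_p(G) ->
    [/\ #|P| = (p ^ (2 * m + 3 * l))%N,
        nil_class P = 5,
        #[A.`_p] = (p ^ (m + l))%N,
        #[B.`_p] = (p ^ (m + l))%N &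
        #[([~ A, B]).`_p] = (p ^ (2 * l - m))%N].
Proof.
move=> p_pr alpha1 beta1 p3 alpha_m beta_m m0 ab_l /andP[ml _] lm [defG relG univ] P sylP.
have p_gt2 : 2 < p by case: p3 => [|[->]] //; apply: ltnW.
(* Changing exponents modulo [M] preserves the relations in [G] and in the models, as well as the
   valuations m and l. *)
have [M [M0 oM pM]] : exists M, [/\ (1 < M)%N, forall x, x \in G -> (#[x] %| M)%N &
    forall k, k <= (m + l).+1 -> (p ^ k %| M)%N].
  exists (#|G| * p ^ (m + l).+1)%N; split=> [|x Gx|k k_le].
  - rewrite -[2]mul1n leq_mul ?cardG_gt0 //; apply: leq_trans (ltnW p_gt2) _.
    by rewrite -[p in X in X <= _]expn1 leq_exp2l ?prime_gt1.
  - by rewrite dvdn_mulr // order_dvdG.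
  by rewrite dvdn_mull // dvdn_exp2l.
(* Consecutive windows force 1 < be < al < be', with [be] and [be'] both standing for beta. *)
have [be [be_lo be_hi be_M]] := nat_representative beta 1 (ltnW M0).
have [al [al_lo al_hi al_M]] := nat_representative alpha 2 (ltnW M0).
have [be' [be'_lo be'_hi be'_M]] := nat_representative beta 3 (ltnW M0).
have be_al : (be < al)%N := leq_trans be_hi al_lo.
have al_be' : (al < be')%N := leq_trans al_hi be'_lo.
have be1 : (1 < be)%N by apply: leq_trans be_lo; rewrite mul1n.
have al1 := ltn_trans be1 be_al; have be'1 := ltn_trans al1 al_be'.
have MpN : (p ^ (m + l) %| M)%N by apply: pM.
have Mpm : (p ^ m.+1 %| M)%N by apply: pM; rewrite ltnS leq_addr.
have Mpl : (p ^ l.+1 %| M)%N by apply: pM; rewrite ltnS leq_addl.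
have val1 n (z : int) : (1 < n)%N -> z != 1%R -> logn p `|(z - 1)%R| = m ->
    (M %| `|(n%:Z - z)%R|)%N -> logn p (n - 1) = m.
  move=> n1 z1 zm nz; have := @logn_congr p m (z - 1)%R (n%:Z - 1)%R p_pr.
  rewrite subr_eq0 => /(_ z1 zm); rewrite opprB addrA subrK.
  by case/(_ (dvdn_trans Mpm nz)) => _; rewrite -[1%R]/(1%:Z)%R distnEl // ltnW.
have al_m := val1 _ _ al1 alpha1 alpha_m al_M.
have be_m := val1 _ _ be1 beta1 beta_m be_M.
have be'_m := val1 _ _ be'1 beta1 beta_m be'_M.
have vall n k (z w : int) : (k <= n)%N -> logn p `|(z - w)%R| = l ->
    (M %| `|(n%:Z - z)%R|)%N -> (M %| `|(k%:Z - w)%R|)%N -> logn p (n - k) = l.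
  move=> kn zw nz kw; have zw0 : (z - w)%R != 0%R.
    by apply/eqP => zw0; move: zw; rewrite zw0 logn0 => l0; rewrite -l0 in ml.
  have [] := @logn_congr p l (z - w)%R (n%:Z - k%:Z)%R p_pr zw0 zw; last by rewrite distnEl.
  apply: dvdn_trans Mpl _.
  rewrite (_ : (_ - _ = (n%:Z - z) - (k%:Z - w))%R); last by ring.
  have E (x : int) : (M %| `|x|)%N = (M%:Z %| x)%Z by rewrite dvdzE absz_nat.
  by rewrite !E in nz kw *; rewrite rpredB.
have [dl [al_be dl_l]] : exists dl, al = (be + dl)%N /\ logn p dl = l.
  exists (al - be)%N; rewrite subnKC ?(ltnW be_al) //; split=> //.
  exact: vall (ltnW be_al) ab_l al_M be_M.
have [dl' [be'_al dl'_l]] : exists dl, be' = (al + dl)%N /\ logn p dl = l.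
  exists (be' - al)%N; rewrite subnKC ?(ltnW al_be') //; split=> //.
  by apply: vall (ltnW al_be') _ be'_M al_M; rewrite -abszN opprB.
have GA : A \in G by rewrite defG mem_gen ?inE ?eqxx.
have GB : B \in G by rewrite defG mem_gen ?inE ?eqxx ?orbT.
have hAB : Mrels al be A B.
  by apply/(Grels_Mrels (dvdn_trans (oM _ GA) al_M) (dvdn_trans (oM _ GB) be_M)).
have hAB' : Mrels al be' A B.
  by apply/(Grels_Mrels (dvdn_trans (oM _ GA) al_M) (dvdn_trans (oM _ GB) be'_M)).
have [P0 [K [dP pP0 p'K defP0 [cE hab]]]] := Mrels_splitting hAB (ltnW al1) (ltnW be1) p_pr.
have [_ [_ [_ _ _ _ [_ hab']]]] := Mrels_splitting hAB' (ltnW al1) (ltnW be'1) p_pr.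
rewrite -defG in dP; have [nP0 _] := dprod_normal2 dP.
have hallP0 : p.-Sylow(G) P0.
  rewrite pHallE (normal_sub nP0) -(dprod_card dP) partnM ?cardG_gt0 //.
  by rewrite (part_pnat_id pP0) (part_p'nat p'K) muln1 eqxx.
(* A normal Sylow subgroup contains every p-subgroup, so it is the only one. *)
have PP0 : P = P0.
  rewrite inE in sylP; apply/group_inj/eqP.
  rewrite eqEcard (sub_normal_Hall hallP0 nP0 (pHall_sub sylP)) (pHall_pgroup sylP).
  by rewrite (card_Hall sylP) (card_Hall hallP0) /=.
(* The first model bounds the orders of [A] and [A, B] from below and has [B] fixing a point; the
   second, with the generators exchanged, bounds the order of [B]. *)
have [T1 [x1 [y1 [t1 [rel1 card1 [ox1 oy1] oc1 [fix1 tr1]]]]]] :=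
  finite_model p_pr p_gt2 (ltnW be1) al_m al_be dl_l ml lm.
have [T2 [x2 [y2 [t2 [rel2 card2 [ox2 oy2] oc2 [fix2 tr2]]]]]] :=
  finite_model p_pr p_gt2 (ltnW al1) be'_m be'_al dl'_l ml lm.
have [f1 [f1A f1B]] : exists f : {morphism G >-> {perm T1}}, f A = x1 /\ f B = y1.
  apply: univ; apply/(Grels_Mrels (al := al) (be := be)) => //.
    by rewrite ox1 (dvdn_trans MpN).
  by rewrite (dvdn_trans oy1) // (dvdn_trans MpN).
have [f2 [f2A f2B]] : exists f : {morphism G >-> {perm T2}}, f A = y2 /\ f B = x2.
  apply: univ; apply/(Grels_Mrels (al := al) (be := be')); last exact: Mrels_sym.
    by rewrite (dvdn_trans oy2) // (dvdn_trans MpN).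
  by rewrite ox2 (dvdn_trans MpN).
have dA : (p ^ (m + l) %| #[A])%N by rewrite -ox1 -f1A morph_order.
have dB : (p ^ (m + l) %| #[B])%N by rewrite -ox2 -f2B morph_order.
have dC : (p ^ (2 * l - m) %| #[[~ A, B]])%N.
  by rewrite (dvdn_trans oc1) // -f1A -f1B -morphR // morph_order // groupR.
have dG : (p ^ (2 * m + 3 * l) %| #|G|)%N.
  have tr t : exists z : {perm T1}, z \in f1 @* G /\ z t1 = t.
    have [z [Hz zt]] := tr1 t; exists z; split=> //; apply: (subsetP _ z Hz).
    by rewrite gen_subG subUset !sub1set -f1A -f1B !mem_morphim.
  have fixB : f1 B t1 = t1 by rewrite f1B.
  apply: dvdn_trans (card_transitive_preim tr GB fixB).
  rewrite card1 (_ : (2 * m + 3 * l = m + 2 * l + (m + l))%N).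
    by rewrite expnD dvdn_mul.
  by clear; lia.
have pa := p_elt_constt p A; have pb := p_elt_constt p B.
have pc : p.-elt [~ A.`_p, B.`_p] by rewrite cE p_elt_constt.
rewrite -cE in defP0; rewrite -PP0 in defP0 pP0 hallP0.
have [a1 b1 c1] := order_bounds p_pr p_gt2 hab hab' pa pb pc be1 al_be be'_al
  al_m be_m be'_m dl_l dl'_l ml lm.
have oA : #[A.`_p] = (p ^ (m + l))%N.
  by rewrite order_constt; apply: part_eq_exp => //; rewrite -order_constt order_dvdn a1.
have oB : #[B.`_p] = (p ^ (m + l))%N.
  by rewrite order_constt; apply: part_eq_exp => //; rewrite -order_constt order_dvdn b1.
have oC : #[[~ A, B].`_p] = (p ^ (2 * l - m))%N.
  by rewrite order_constt; apply: part_eq_exp => //; rewrite -order_constt order_dvdn -cE c1.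
split=> //.
  apply/eqP; rewrite eqn_leq.
  rewrite (card_le p_pr p_gt2 hab pP0 defP0 al1 be1 al_m be_m ml lm a1 b1 c1 al_be dl_l).
  rewrite dvdn_leq ?cardG_gt0 // (card_Hall hallP0) p_part dvdn_exp2l //.
  by rewrite -pfactor_dvdn ?cardG_gt0.
apply/eqP; rewrite eqn_leq.
rewrite (class_ge5 p_pr p_gt2 hab pP0 defP0 al1 al_m ml lm oA) andbT.
apply/(ucn_nil_classP 5 (pgroup_nil pP0)).
exact: (class_le5 p_pr p_gt2 hab pP0 defP0 al1 be1 al_m be_m ml lm a1 b1 c1).
Qed.
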